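(* In the setting of the $\phi$-Laplace problem and its Crouzeix--Raviart/Raviart--Thomas discretisation described in the context (exact solution $(u,\mathbf{q})$, discrete solution $(u_h,\mathbf{q}_h)$), the following discrete error identity holds for all $v_h\in V^h_D$ and $\mathbf{r}_h\in K_h$: $$\int_\Omega\mathcal{D}_\phi(\nabla_hv_h,\nabla_hu_h)+\int_\Omega\mathcal{D}_{\phi^*}(\Pi_h\mathbf{r}_h,\Pi_h\mathbf{q}_h)=\int_\Omega\big[\phi(\nabla_hv_h)-\Pi_h\mathbf{r}_h\cdot\nabla_hv_h+\phi^*(\Pi_h\mathbf{r}_h)\big].$$ Consequently, there are constants $c,C>0$, depending only on the uniform convexity constants $c_{\mathrm{uc}},C_{\mathrm{uc}}$ of $\widehat\phi$, such that with $$E_h=\int_\Omega\mathcal{D}_\phi(\nabla_hu_h,\nabla u)+\int_\Omega\mathcal{D}_{\phi^*}(\Pi_h\mathbf{q}_h,\mathbf{q}),\qquad B_h=\inf_{v_h\in V^h_D}\int_\Omega\mathcal{D}_\phi(\nabla_hv_h,\nabla u)+\inf_{\mathbf{r}_h\in K_h}\int_\Omega\mathcal{D}_{\phi^*}(\Pi_h\mathbf{r}_h,\mathbf{q}),$$ one has $c\,B_h\le E_h\le C\,B_h$.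
   Context: **Uniformly convex N-functions.** $\widehat\phi\colon[0,\infty)\to[0,\infty)$ is an N-function if it is continuous and convex and $\widehat\phi(t)=\int_0^t\widehat\phi'(s)\,ds$ with $\widehat\phi'$ right-continuous, non-decreasing, $\widehat\phi'(0)=0$, $\widehat\phi'(s)>0$ for $s>0$, $\lim_{s\to\infty}\widehat\phi'(s)=\infty$. It is uniformly convex with constants $c_{\mathrm{uc}},C_{\mathrm{uc}}>0$ if for all $0\le t<s$ $$c_{\mathrm{uc}}\frac{\widehat\phi'(s)-\widehat\phi'(t)}{s-t}\le\frac{\widehat\phi'(s)}{s}\le C_{\mathrm{uc}}\frac{\widehat\phi'(s)-\widehat\phi'(t)}{s-t}.$$ The conjugate $\widehat\phi^*(t)=\max_{s\ge0}(st-\widehat\phi(s))$ is again a uniformly convex N-function. Set $\phi(\mathbf{a})=\widehat\phi(|\mathbf{a}|)$, $\phi^*(\mathbf{a})=\widehat\phi^*(|\mathbf{a}|)$ for $\mathbf{a}\in\mathbb{R}^d$. Let $\mathcal{A}(\mathbf{a})=\frac{\widehat\phi'(|\mathbf{a}|)}{|\mathbf{a}|}\mathbf{a}$ and $\mathcal{A}^{-1}(\mathbf{b})=\frac{(\widehat\phi^* )'(|\mathbf{b}|)}{|\mathbf{b}|}\mathbf{b}$, both with value $0$ at $0$; they are mutually inverse and are the gradients of $\phi$ and $\phi^*$. **Bregman divergences.** $\mathcal{D}_\phi(\mathbf{a},\mathbf{b})=\phi(\mathbf{a})-\phi(\mathbf{b})-\mathcal{A}(\mathbf{b})\cdot(\mathbf{a}-\mathbf{b})$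 and $\mathcal{D}_{\phi^*}(\mathbf{a},\mathbf{b})=\phi^*(\mathbf{a})-\phi^*(\mathbf{b})-\mathcal{A}^{-1}(\mathbf{b})\cdot(\mathbf{a}-\mathbf{b})$. **Continuous problem.** $\Omega\subset\mathbb{R}^d$ is a bounded polyhedral Lipschitz domain whose boundary is split into relatively open disjoint parts $\Gamma_D,\Gamma_N$ covering $\partial\Omega$ up to a set of zero surface measure, with outward unit normal $\mathbf{n}$. $L^\phi,L^{\phi^*}$ are the Orlicz spaces of $\widehat\phi,\widehat\phi^*$, and $W^{1,\phi}_D(\Omega)$ is the Orlicz--Sobolev space of functions $v$ with $v,|\nabla v|\in L^\phi(\Omega)$ and zero trace on $\Gamma_D$. Given $f\in L^{\phi^*}(\Omega)$, $\mathbf{F}\in L^{\phi^*}(\Omega)^d$, $g\in L^{\phi^*}(\Gamma_N)$, let $$I(v)=\int_\Omega\phi(\nabla v)-\int_\Omega fv-\int_\Omega\mathbf{F}\cdot\nabla v-\int_{\Gamma_N}gv.$$ $u\in W^{1,\phi}_D(\Omega)$ is the primal solution (the minimiser of $I$ on $W^{1,\phi}_D(\Omega)$), and $\mathbf{q}$ is the dual solution, characterised by $\mathbf{q}=\mathcal{A}(\nabla u)$ a.e. in $\Omega$ (equivalently $\nabla u=\mathcal{A}^{-1}(\mathbf{q})$). **Discretisation.** $\mathcal{T}_h$ is a conforming shape-regular simplicial triangulation of $\Omega$, each of whose boundary facets is contained in (the closure of) either $\Gamma_D$ or $\Gamma_N$; $x_F$ denotes the midpoint (barycenter) of a facet $F$,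 and $x_T$ the barycenter of $T$. $\nabla_h$ is the piecewise gradient, $\Pi_h$ the $L^2$-projection onto piecewise constants on $\mathcal{T}_h$ (applied componentwise to vector fields), and $\pi_h$ the projection onto facet-wise constants on $\Gamma_N$. $V^h$ is the Crouzeix--Raviart space of piecewise affine functions that are continuous at $x_F$ for all facets $F$; $V^h_D=\{v_h\in V^h:v_h(x_F)=0\text{ for all facets }F\subset\overline{\Gamma_D}\}$. $\Sigma^h$ is the lowest-order Raviart--Thomas space of $\mathbf{r}_h\in L^1(\Omega)^d$ with $\mathrm{div}\,\mathbf{r}_h\in L^1(\Omega)$ and $\mathbf{r}_h|_T(x)=a_T+b_T(x-x_T)$, $a_T\in\mathbb{R}^d$, $b_T\in\mathbb{R}$, for all $T\in\mathcal{T}_h$. Let $f_h=\Pi_hf$, $\mathbf{F}_h=\Pi_h\mathbf{F}$, $g_h=\pi_hg$, and for $v_h\in V^h_D$ $$I_h(v_h)=\int_\Omega\phi(\nabla_hv_h)-\int_\Omega f_hv_h-\int_\Omega\mathbf{F}_h\cdot\nabla_hv_h-\int_{\Gamma_N}g_hv_h.$$ Let $$K_h=\{\mathbf{r}_h\in\mathbf{F}_h+\Sigma^h:\ \mathrm{div}(\mathbf{r}_h-\mathbf{F}_h)=-f_h\text{ in }\Omega,\ (\mathbf{r}_h-\mathbf{F}_h)\cdot\mathbf{n}=g_h\text{ on }\Gamma_N\}$$ be the domain of the discrete dual energy, which equals $D_h(\mathbf{r}_h)=-\int_\Omega\phi^*(\Pi_h\mathbf{r}_h)$ on $K_h$ (and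 $-\infty$ elsewhere). $u_h\in V^h_D$ is the unique minimiser of $I_h$ on $V^h_D$ and $\mathbf{q}_h\in K_h$ is the maximiser of $D_h$. In this setting it is known that discrete strong duality $I_h(u_h)=D_h(\mathbf{q}_h)$ holds and that $\Pi_h\mathbf{q}_h=\mathcal{A}(\nabla_hu_h)$ a.e. in $\Omega$. One also has the discrete integration-by-parts formula $\int_\Omega(v_h\,\mathrm{div}\,\mathbf{r}_h+\mathbf{r}_h\cdot\nabla_hv_h)=0$ for all $v_h\in V^h_D$ and all $\mathbf{r}_h\in\Sigma^h$ with $\mathbf{r}_h\cdot\mathbf{n}=0$ on $\Gamma_N$. *)

(* Defs.v *)
From HB Require Import structures.
From mathcomp Require Import all_boot all_order all_algebra.
From mathcomp Require Import all_classical all_reals all_analysis.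
From mathcomp Require Import measurable_realfun.
Set Implicit Arguments.
Unset Strict Implicit.
Unset Printing Implicit Defensive.
Import Order.TTheory GRing.Theory Num.Theory.
Import numFieldNormedType.Exports.
Local Open Scope classical_set_scope.
Local Open Scope ring_scope.

Section rV_measurable.
Variables (R : realType) (n : nat).

Definition rV_coord (i : 'I_n) (x : 'rV[R]_n) : measurableTypeR R := x ord0 i.

Let rV_set0 : g_sigma_preimage rV_coord set0.
Proof. exact: sigma_algebra0. Qed.
Let rV_setC A : g_sigma_preimage rV_coord A -> g_sigma_preimage rV_coord (~` A).
Proof. exact: sigma_algebraC. Qed.
Let rV_bigcup (F : (set 'rV[R]_n)^nat) :
  (forall i, g_sigma_preimage rV_coord (F i)) ->
  g_sigma_preimage rV_coord (\bigcup_i (F i)).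
Proof. exact: sigma_algebra_bigcup. Qed.
(* The sigma-algebra generated by the coordinates, i.e. the Borel sets. *)
HB.instance Definition _ :=
  @isMeasurable.Build (measure_tuple_display default_measure_display)
    'rV[R]_n (g_sigma_preimage rV_coord) rV_set0 rV_setC rV_bigcup.
End rV_measurable.


Section lebesgue_rV.
Variable R : realType.

Lemma measurable_rV_coord n (i : 'I_n) : measurable_fun setT (@rV_coord R n i).
Proof.
move=> _ Y mY; rewrite setTI; apply: sub_sigma_algebra => /=.
rewrite -bigcup_seq/=; exists i => /=; first by rewrite mem_index_enum.
by exists Y => //; rewrite setTI.
Qed.

Lemma measurable_fun_rV d (T : measurableType d) n (f : T -> 'rV[R]_n) :
  (forall i, measurable_fun setT (rV_coord i \o f)) -> measurable_fun setT f.
Proof.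
move=> mf; apply: (@measurability _ _ _ _ _ _ (\big[setU/set0]_(i < n)
  preimage_set_system setT (@rV_coord R n i) measurable)) => //.
move=> _ [A + <-]; rewrite -bigcup_seq/= => -[i _ [B mB <-]].
by rewrite !setTI; have := mf i measurableT _ mB; rewrite setTI.
Qed.

Definition rV_cons n (p : measurableTypeR R * 'rV[R]_n) : 'rV[R]_n.+1 :=
  row_mx (const_mx p.1 : 'rV_1) p.2.

Definition rV_uncons n (x : 'rV[R]_n.+1) : measurableTypeR R * 'rV[R]_n :=
  (x ord0 ord0, rsubmx (x : 'rV_(1 + n))).

Lemma rV_consK n : cancel (@rV_cons n) (@rV_uncons n).
Proof.
case=> a x; rewrite /rV_uncons /rV_cons row_mxKr; congr pair.
rewrite (_ : ord0 = lshift n (ord0 : 'I_1)); last exact/val_inj.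
by rewrite (row_mxEl (const_mx a : 'rV_1)) mxE.
Qed.

Lemma measurable_rV_cons n : measurable_fun setT (@rV_cons n).
Proof.
apply: measurable_fun_rV => i.
have [->|[j ->]] : i = ord0 \/ exists j, i = lift ord0 j.
  by case: (unliftP ord0 i) => [j ->|->]; [right; exists j|left].
- rewrite (_ : _ \o _ = fst)//; apply/funext => p /=.
  by rewrite /rV_coord -[in RHS](rV_consK p).
- rewrite (_ : _ \o _ = @rV_coord R n j \o snd).
    exact: (measurableT_comp (measurable_rV_coord j) measurable_snd).
  apply/funext => p /=.
  rewrite /rV_coord /rV_cons (_ : lift ord0 j = rshift 1 j); last exact/val_inj.
  by rewrite (row_mxEr (const_mx p.1 : 'rV_1)).
Qed.

Lemma measurable_rV_uncons n : measurable_fun setT (@rV_uncons n).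
Proof.
apply: (measurable_fun_pair (measurable_rV_coord ord0)).
apply: measurable_fun_rV => i.
rewrite (_ : _ \o _ = rV_coord (lift ord0 i)); first exact: measurable_rV_coord.
apply/funext => x; rewrite /= /rV_coord mxE.
by rewrite (_ : lift ord0 i = rshift 1 i)//; exact/val_inj.
Qed.

Section step.
Variables (n : nat) (m : {sigma_finite_measure set 'rV[R]_n -> \bar R}).

Definition lebesgue_rV_step : set 'rV[R]_n.+1 -> \bar R :=
  pushforward (@lebesgue_measure R \x m)%E (@rV_cons n).

Let step0 : lebesgue_rV_step set0 = 0%E.
Proof. by rewrite /lebesgue_rV_step /pushforward preimage_set0 measure0. Qed.

Let step_ge0 A : (0 <= lebesgue_rV_step A)%E.
Proof. by rewrite /lebesgue_rV_step /pushforward measure_ge0. Qed.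

Let step_additive : semi_sigma_additive lebesgue_rV_step.
Proof.
move=> F mF tF mUF; rewrite /lebesgue_rV_step /pushforward preimage_bigcup.
apply: measure_semi_sigma_additive.
- by move=> k; rewrite -[X in measurable X]setTI; exact: measurable_rV_cons.
- apply/trivIsetP => i j _ _ ij; rewrite -preimage_setI.
  by move/trivIsetP : tF => /(_ i j Logic.I Logic.I ij) ->; rewrite preimage_set0.
- rewrite -preimage_bigcup -[X in measurable X]setTI.
  exact: measurable_rV_cons.
Qed.

HB.instance Definition _ := isMeasure.Build _ _ _ lebesgue_rV_step
  step0 step_ge0 step_additive.

Let step_sigma_finite : sigma_finite setT lebesgue_rV_step.
Proof.
have /sigma_finiteP[F [UF ndF Foo]] := sigma_finiteT (@lebesgue_measure R).
have /sigma_finiteP[G [UG ndG Goo]] := sigma_finiteT m.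
exists (fun k => @rV_uncons n @^-1` (F k `*` G k)) => [|k].
  apply/seteqP; split=> // x _.
  have [i _ Fi] : (\bigcup_k F k) (rV_uncons x).1 by rewrite -UF.
  have [j _ Gj] : (\bigcup_k G k) (rV_uncons x).2 by rewrite -UG.
  exists (maxn i j) => //; split.
    by move: Fi; exact/subsetPset/ndF/leq_maxl.
  by move: Gj; exact/subsetPset/ndG/leq_maxr.
have [[mF Fk] [mG Gk]] := (Foo k, Goo k); split.
  rewrite -[X in measurable X]setTI.
  by apply: measurable_rV_uncons => //; exact: measurableX.
have consE : @rV_cons n @^-1` (@rV_uncons n @^-1` (F k `*` G k)) = F k `*` G k.
  by rewrite -comp_preimage (_ : _ \o _ = id)//; apply/funext/rV_consK.
rewrite /lebesgue_rV_step /pushforward consE.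
by rewrite product_measure1E// lte_mul_pinfty// ge0_fin_numE.
Qed.

HB.instance Definition _ := Measure_isSigmaFinite.Build _ _ _ lebesgue_rV_step
  step_sigma_finite.

End step.

Fixpoint lebesgue_rV n : {sigma_finite_measure set 'rV[R]_n -> \bar R} :=
  match n with
  | 0 => dirac (0 : 'rV[R]_0)
  | k.+1 => lebesgue_rV_step (lebesgue_rV k)
  end.

End lebesgue_rV.

Section euclidean.
Context {R : realType} {n : nat}.
Implicit Types (x y : 'rV[R]_n).

Definition dot x y : R := \sum_j x ord0 j * y ord0 j.

(* The library norm on matrices is the sup norm. *)
Definition enorm x : R := Num.sqrt (dot x x).

End euclidean.

Section N_functions.
Context {R : realType}.
Implicit Types (phi : R -> R) (c C : R).

(* Functions on [0, +oo) are represented by functions on R of which only the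
   values on [0, +oo) matter; the right derivative is then the right-continuous
   derivative at every point of [0, +oo), including 0. *)
Definition rderiv phi (t : R) : R :=
  lim ((fun h => h^-1 * (phi (t + h) - phi t)) @ 0^'+).

Definition is_Nfunction phi : Prop :=
  [/\ forall t, 0 <= t -> 0 <= phi t,
      {within `[0, +oo[, continuous phi},
      (forall s t l, 0 <= s -> 0 <= t -> 0 <= l <= 1 ->
        phi (l * s + (1 - l) * t) <= l * phi s + (1 - l) * phi t),
      (forall t, 0 <= t ->
        phi t = \int[lebesgue_measure]_(s in `[0, t]) rderiv phi s) &
      [/\ forall t, 0 <= t -> rderiv phi s @[s --> t^'+] --> rderiv phi t,
          forall s t, 0 <= s -> s <= t -> rderiv phi s <= rderiv phi t,
          rderiv phi 0 = 0,
          forall s, 0 < s -> 0 < rderiv phi s &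
          rderiv phi s @[s --> +oo] --> +oo]].

Definition uniformly_convex c C phi : Prop :=
  forall t s, 0 <= t -> t < s ->
    c * ((rderiv phi s - rderiv phi t) / (s - t)) <= rderiv phi s / s /\
    rderiv phi s / s <= C * ((rderiv phi s - rderiv phi t) / (s - t)).

Definition conjugate phi (t : R) : R :=
  sup [set s * t - phi s | s in [set s | 0 <= s]].

Context {n : nat}.
Implicit Types a b : 'rV[R]_n.

(* [flux phi] is A and [flux (conjugate phi)] is A^{-1}; the value at 0 is 0. *)
Definition flux phi a : 'rV[R]_n := (rderiv phi (enorm a) / enorm a) *: a.

Definition bregman phi a b : R :=
  phi (enorm a) - phi (enorm b) - dot (flux phi b) (a - b).

End N_functions.

Section orlicz.
Context {d : measure_display} {T : measurableType d} {R : realType} {n : nat}.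
Implicit Types (mu : set T -> \bar R) (phi : R -> R) (D : set T).

Definition orlicz mu phi D (f : T -> R) : Prop :=
  measurable_fun D f /\
  exists2 k : R, 0 < k & (\int[mu]_(x in D) (phi (`|f x| / k))%:E < +oo)%E.

Definition orlicz_vec mu phi D (F : T -> 'rV[R]_n) : Prop :=
  measurable_fun D F /\ orlicz mu phi D (enorm \o F).

End orlicz.

Section weak_derivatives.
Context {R : realType} {n : nat}.
Local Notation rV := 'rV[R]_n.+1.
Local Notation leb := (lebesgue_rV R n.+1).
Implicit Types (f v w : rV -> R) (G r : rV -> rV) (Omega : set rV).

Definition partial (j : 'I_n.+1) f : rV -> R := 'D_(delta_mx ord0 j) f.

Definition grad f (x : rV) : rV := \row_j partial j f x.

Fixpoint is_Ck (k : nat) f : Prop :=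
  continuous f /\
  match k with
  | 0 => True
  | k'.+1 => forall j, (forall x, derivable f x (delta_mx ord0 j)) /\
                       is_Ck k' (partial j f)
  end.

Definition smooth f : Prop := forall k, is_Ck k f.

Definition test_function Omega f : Prop :=
  [/\ smooth f, compact (closure [set x | f x != 0]) &
      closure [set x | f x != 0] `<=` Omega].

Definition weak_grad Omega v G : Prop :=
  forall eta, test_function Omega eta -> forall j,
    \int[leb]_(x in Omega) (v x * partial j eta x) =
    - \int[leb]_(x in Omega) (G x ord0 j * eta x).

Definition weak_div Omega r w : Prop :=
  forall eta, test_function Omega eta ->
    \int[leb]_(x in Omega) dot (r x) (grad eta x) =
    - \int[leb]_(x in Omega) (w x * eta x).

End weak_derivatives.

Section domain.
Context {R : realType} {n : nat}.
Local Notation rV := 'rV[R]_n.+1.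
Implicit Types Omega : set rV.

Definition bdry Omega : set rV := closure Omega `\` Omega^°.

(* Near each boundary point, after a rigid motion, Omega is the strict
   epigraph of a Lipschitz function. *)
Definition lipschitz_boundary Omega : Prop :=
  forall x, bdry Omega x ->
    exists (r L : R) (Q : 'M[R]_n.+1) (gamma : 'rV[R]_n -> R),
      [/\ 0 < r, Q *m Q^T = 1%:M,
          forall a b, `|gamma a - gamma b| <= L * enorm (a - b) &
          forall y, enorm (y - x) < r ->
            let z := (y - x) *m Q in
            (Omega y <-> gamma (\row_j z ord0 (lift ord0 j)) < z ord0 ord0)].

(* Polyhedrality is part of [triangulation] below. *)
Definition bounded_lipschitz_domain Omega : Prop :=
  [/\ Omega !=set0, open Omega, connected Omega, bounded_set Omega &
      lipschitz_boundary Omega].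

End domain.

Section simplices.
Context {R : realType} {n : nat}.
Local Notation rV := 'rV[R]_n.

Definition face m (p : 'I_m -> rV) (J : 'I_m -> Prop) : set rV :=
  [set x | exists l : 'I_m -> R,
     [/\ forall j, 0 <= l j, forall j, ~ J j -> l j = 0,
         \sum_j l j = 1 & x = \sum_j l j *: p j]].

Definition simplex m (p : 'I_m -> rV) : set rV := face p (fun=> True).

Definition barycenter m (p : 'I_m -> rV) : rV := m%:R^-1 *: \sum_j p j.

Definition edges m (p : 'I_m.+1 -> rV) : 'M[R]_(m, n) :=
  \matrix_(j < m) (p (lift ord0 j) - p ord0).

End simplices.

Section meshes.
Context {R : realType} {n : nat}.
Local Notation rV := 'rV[R]_n.+1.
Local Notation leb := (lebesgue_rV R n.+1).

Record mesh := Mesh {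
  elt : finType;
  vert : elt -> 'I_n.+2 -> rV
}.

Variables (M : mesh) (Omega : set rV).
Implicit Types (i : elt M) (k : 'I_n.+2).

Definition cell i : set rV := (simplex (vert i))^°.

Definition xT i : rV := barycenter (vert i).

(* The facet (i, k) is the facet of the element i opposite to its vertex k. *)
Definition fvert i k (j : 'I_n.+1) : rV := vert i (lift k j).

Definition facet i k : set rV := simplex (fvert i k).

Definition xF i k : rV := barycenter (fvert i k).

Definition outward_normal i k (nu : rV) : Prop :=
  [/\ enorm nu = 1, forall x y, facet i k x -> facet i k y -> dot nu (x - y) = 0
    & dot nu (vert i k - xF i k) < 0].

Definition triangulation : Prop :=
  [/\ forall i : elt M, row_free (edges (vert i)),
      closure Omega = \bigcup_(i : elt M) simplex (vert i),
      injective (fun i : elt M => simplex (vert i)) &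
      forall i j : elt M, simplex (vert i) `&` simplex (vert j) =
        face (vert i) (fun a => exists b, vert i a = vert j b)].

(* The diameter of a simplex is its largest edge length; the ratio of diameter
   to inradius is at most kappa. *)
Definition shape_regular (kappa : R) : Prop :=
  forall i, exists (x : rV) (rho : R),
    [/\ 0 < rho, forall y, enorm (y - x) <= rho -> simplex (vert i) y &
        forall a b, enorm (vert i a - vert i b) <= kappa * rho].

Definition bfacet (p : elt M * 'I_n.+2) : bool :=
  `[< facet p.1 p.2 `<=` bdry Omega >].

(* Surface measure on the boundary: each boundary facet is the affine image of
   the reference simplex of dimension n under [fparam], whose area factor is
   the square root of the Gram determinant of the edges. *)
Definition ref_simplex : set 'rV[R]_n :=
  [set s | (forall j, 0 <= s ord0 j) /\ \sum_j s ord0 j <= 1].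

Definition fparam (p : elt M * 'I_n.+2) (s : 'rV[R]_n) : rV :=
  fvert p.1 p.2 ord0 + s *m edges (fvert p.1 p.2).

Definition farea (p : elt M * 'I_n.+2) : R :=
  let E := edges (fvert p.1 p.2) in Num.sqrt (\det (E *m E^T)).

Definition surf (A : set rV) : \bar R :=
  (\sum_(p | bfacet p)
     (farea p)%:E * lebesgue_rV R n (ref_simplex `&` fparam p @^-1` A))%E.

Lemma measurable_ref_simplex : measurable ref_simplex.
Proof.
have mc j : measurable_fun setT (fun s : 'rV[R]_n => s ord0 j : R).
  exact: measurable_rV_coord.
rewrite (_ : ref_simplex =
    \bigcap_(j in [set: 'I_n]) ((fun s => s ord0 j) @^-1` `[0, +oo[) `&`
    (fun s => \sum_j s ord0 j) @^-1` `]-oo, 1]); last first.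
  apply/seteqP; split=> s /=.
    by move=> [s0 s1]; split=> [j _ /=|]; rewrite in_itv/= ?s0 ?s1.
  move=> [s0]; rewrite in_itv/= => s1; split=> // j.
  by have := s0 j Logic.I; rewrite /= in_itv/= andbT.
apply: measurableI.
  apply: fin_bigcap_measurable => // j _.
  by rewrite -[X in measurable X]setTI; exact: mc.
have ms : measurable_fun setT (fun s : 'rV[R]_n => \sum_j s ord0 j).
  by apply: measurable_sum => j; exact: mc.
by rewrite -[X in measurable X]setTI; exact: ms.
Qed.

Lemma measurable_fparam p : measurable_fun setT (fparam p).
Proof.
apply: measurable_fun_rV => k.
have -> : rV_coord k \o fparam p = fun s : 'rV[R]_n =>
    fvert p.1 p.2 ord0 ord0 k +
    \sum_j s ord0 j * edges (fvert p.1 p.2) j k.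
  by apply/funext => s; rewrite /= /rV_coord !mxE.
have ms : measurable_fun setT (fun s : 'rV[R]_n =>
    \sum_j s ord0 j * edges (fvert p.1 p.2) j k).
  apply: measurable_sum => j; apply: measurable_funM => //.
  exact: measurable_rV_coord.
exact: measurable_funD.
Qed.

Let measurable_chart p A : measurable A ->
  measurable (ref_simplex `&` fparam p @^-1` A).
Proof.
move=> mA; apply: measurableI; first exact: measurable_ref_simplex.
by rewrite -[X in measurable X]setTI; exact: measurable_fparam.
Qed.

Let surf0 : surf set0 = 0%E.
Proof.
by rewrite /surf big1// => p _; rewrite preimage_set0 setI0 measure0 mule0.
Qed.

Let surf_ge0 A : (0 <= surf A)%E.
Proof. by apply: sume_ge0 => p _; rewrite mule_ge0// lee_fin sqrtr_ge0. Qed.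

Let surf_additive : semi_sigma_additive surf.
Proof.
move=> A mA tA mUA; rewrite /surf.
under eq_fun do rewrite exchange_big/=.
apply: cvg_nnesum => p _.
  by apply: nearW => k; apply: sume_ge0 => j _; rewrite mule_ge0// lee_fin sqrtr_ge0.
under eq_fun do rewrite -ge0_sume_distrr//.
apply: cvgeZl => //; rewrite preimage_bigcup setI_bigcupr.
apply: measure_semi_sigma_additive.
- by move=> k; exact: measurable_chart.
- apply/trivIsetP => i j _ _ ij.
  move/trivIsetP : tA => /(_ i j Logic.I Logic.I ij) Aij.
  rewrite -subset0 => s [[_ Ais] [_ Ajs]].
  by have : (A i `&` A j) (fparam p s) by []; rewrite Aij.
- by rewrite -setI_bigcupr -preimage_bigcup; exact: measurable_chart.
Qed.

HB.instance Definition _ := isMeasure.Build _ _ _ surf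
  surf0 surf_ge0 surf_additive.

Definition boundary_parts (GD GN : set rV) : Prop :=
  [/\ (exists2 U, open U & GD = bdry Omega `&` U),
      (exists2 U, open U & GN = bdry Omega `&` U),
      GD `&` GN = set0,
      surf (bdry Omega `\` (GD `|` GN)) = 0%E &
      forall p, bfacet p ->
        facet p.1 p.2 `<=` closure GD \/ facet p.1 p.2 `<=` closure GN].

End meshes.

Arguments mesh : clear implicits.

Section sobolev.
Context {R : realType} {n : nat}.
Local Notation rV := 'rV[R]_n.+1.
Local Notation leb := (lebesgue_rV R n.+1).
Variables (M : mesh R n) (Omega GD GN : set rV).
Local Notation surf := (surf M Omega).

(* A Sobolev function together with its weak gradient and its boundary trace,
   which are determined by it almost everywhere. *)
Record sobolev := Sobolev {
  sval : rV -> R;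
  sgrad : rV -> rV;
  strace : rV -> R
}.
Implicit Types U : sobolev.

(* The trace operator on W^{1,1} is the continuous extension, with values in
   L^1 of the boundary, of the restriction of smooth functions. *)
Definition has_trace (v : rV -> R) (G : rV -> rV) (tv : rV -> R) : Prop :=
  measurable_fun (bdry Omega) tv /\
  exists w : nat -> rV -> R,
    [/\ forall k, smooth (w k),
        (\int[leb]_(x in Omega)
           (`|w k x - v x| + enorm (grad (w k) x - G x))%:E)%E
          @[k --> \oo] --> 0%E &
        (\int[surf]_(x in bdry Omega) `|w k x - tv x|%:E)%E
          @[k --> \oo] --> 0%E].

Definition W1D (phi : R -> R) (U : sobolev) : Prop :=
  [/\ orlicz leb phi Omega (sval U), orlicz_vec leb phi Omega (sgrad U),
      weak_grad Omega (sval U) (sgrad U),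
      has_trace (sval U) (sgrad U) (strace U) &
      {ae surf, forall x, GD x -> strace U x = 0}].

Variables (phi : R -> R) (f : rV -> R) (F : rV -> rV) (g : rV -> R).

Definition energy (U : sobolev) : R :=
  \int[leb]_(x in Omega) phi (enorm (sgrad U x))
  - \int[leb]_(x in Omega) (f x * sval U x)
  - \int[leb]_(x in Omega) dot (F x) (sgrad U x)
  - \int[surf]_(x in GN) (g x * strace U x).

Definition primal_solution (U : sobolev) : Prop :=
  W1D phi U /\ forall V, W1D phi V -> energy U <= energy V.

Definition dual_solution (U : sobolev) (q : rV -> rV) : Prop :=
  orlicz_vec leb (conjugate phi) Omega q /\
  {ae leb, forall x, Omega x -> q x = flux phi (sgrad U x)}.

End sobolev.

Section discretisation.
Context {R : realType} {n : nat}.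
Local Notation rV := 'rV[R]_n.+1.
Local Notation leb := (lebesgue_rV R n.+1).
Variables (M : mesh R n) (Omega GD GN : set rV).
Local Notation surf := (surf M Omega).
Local Notation bfacet := (bfacet Omega).

(* Elementwise given functions as functions defined almost everywhere in Omega;
   the value on the skeleton of the mesh is 0. *)
Definition piecewise (V : zmodType) (h : elt M -> rV -> V) (x : rV) : V :=
  \sum_(i | x \in cell i) h i x.

Definition facetwise (h : elt M * 'I_n.+2 -> rV -> R) (x : rV) : R :=
  \sum_(p | bfacet p && (x \in facet p.1 p.2)) h p x.

Definition mean (f : rV -> R) (i : elt M) : R :=
  (fine (leb (cell i)))^-1 * \int[leb]_(x in cell i) f x.

(* The L^2-projections onto elementwise or facetwise constants are the
   averages, which also make sense for merely integrable data. *)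
Definition Pih (f : rV -> R) : rV -> R := piecewise (fun i _ => mean f i).

Definition Pihv (F : rV -> rV) : rV -> rV :=
  piecewise (fun i _ => \row_j mean (fun x => F x ord0 j) i).

Definition pih (g : rV -> R) (p : elt M * 'I_n.+2) : R :=
  (fine (surf (facet p.1 p.2)))^-1 *
  \int[surf]_(x in facet p.1 p.2 `&` GN) g x.

(* [v i] is the value at the barycenter and the gradient on the element i. *)
Definition p1 := elt M -> R * rV.

Definition p1_at (v : p1) (i : elt M) (x : rV) : R :=
  (v i).1 + dot (v i).2 (x - xT i).

Definition p1_fun (v : p1) : rV -> R := piecewise (p1_at v).

Definition p1_grad (v : p1) : rV -> rV := piecewise (fun i _ => (v i).2).

Definition Vh : set p1 :=
  [set v | forall i k j, simplex (vert j) (xF i k) ->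
     p1_at v i (xF i k) = p1_at v j (xF i k)].

Definition VhD : set p1 :=
  [set v | Vh v /\
     forall i k, facet i k `<=` closure GD -> p1_at v i (xF i k) = 0].

(* [s i] is the pair (a_T, b_T) for the element T of index i. *)
Definition rt := elt M -> rV * R.

Definition rt_at (s : rt) (i : elt M) (x : rV) : rV :=
  (s i).1 + (s i).2 *: (x - xT i).

Definition rt_fun (s : rt) : rV -> rV := piecewise (rt_at s).

Definition Sigmah : set rt :=
  [set s | exists2 w : rV -> R,
     leb.-integrable Omega (EFin \o w) & weak_div Omega (rt_fun s) w].

Definition normal_trace_eq (s : rt) (c : elt M * 'I_n.+2 -> R) : Prop :=
  forall i k nu x, bfacet (i, k) -> outward_normal i k nu ->
    facet i k x -> GN x -> dot (rt_at s i x) nu = c (i, k).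

Variables (phi : R -> R) (f : rV -> R) (F : rV -> rV) (g : rV -> R).

Definition Kh : set (rV -> rV) :=
  [set r | exists s : rt,
     [/\ Sigmah s, r = (fun x => Pihv F x + rt_fun s x),
         weak_div Omega (rt_fun s) (fun x => - Pih f x) &
         normal_trace_eq s (pih g)]].

Definition Ih (v : p1) : R :=
  \int[leb]_(x in Omega) phi (enorm (p1_grad v x))
  - \int[leb]_(x in Omega) (Pih f x * p1_fun v x)
  - \int[leb]_(x in Omega) dot (Pihv F x) (p1_grad v x)
  - \int[surf]_(x in GN)
      (facetwise (fun p _ => pih g p) x * facetwise (fun p => p1_at v p.1) x).

Definition Dh (r : rV -> rV) : R :=
  - \int[leb]_(x in Omega) conjugate phi (enorm (Pihv r x)).

Definition discrete_solution (uh : p1) (qh : rV -> rV) : Prop :=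
  [/\ VhD uh, forall v, VhD v -> Ih uh <= Ih v,
      Kh qh & forall r, Kh r -> Dh r <= Dh qh].

(* Known facts of the discrete setting: the pointwise relation between the
   discrete primal and dual solutions, and discrete integration by parts. *)
Definition discrete_flux_relation (uh : p1) (qh : rV -> rV) : Prop :=
  {ae leb, forall x, Omega x -> Pihv qh x = flux phi (p1_grad uh x)}.

Definition discrete_integration_by_parts : Prop :=
  forall (v : p1) (s : rt) (w : rV -> R),
    VhD v -> leb.-integrable Omega (EFin \o w) ->
    weak_div Omega (rt_fun s) w -> normal_trace_eq s (fun=> 0) ->
    \int[leb]_(x in Omega) (p1_fun v x * w x + dot (rt_fun s x) (p1_grad v x))
      = 0.

Local Notation phistar := (conjugate phi).

Definition Eh (gradu q : rV -> rV) (uh : p1) (qh : rV -> rV) : \bar R :=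
  (\int[leb]_(x in Omega) (bregman phi (p1_grad uh x) (gradu x))%:E +
   \int[leb]_(x in Omega) (bregman phistar (Pihv qh x) (q x))%:E)%E.

Definition Bh (gradu q : rV -> rV) : \bar R :=
  (ereal_inf [set \int[leb]_(x in Omega)
                (bregman phi (p1_grad v x) (gradu x))%:E | v in VhD] +
   ereal_inf [set \int[leb]_(x in Omega)
                (bregman phistar (Pihv r x) (q x))%:E | r in Kh])%E.

End discretisation.

(* Main.v *)
Require Import Defs.
From mathcomp Require Import all_boot all_order all_algebra.
From mathcomp Require Import all_classical all_reals all_analysis.
From mathcomp Require Import measurable_realfun ring lra.
Import Order.TTheory GRing.Theory Num.Theory.
Import numFieldNormedType.Exports.
Local Open Scope classical_set_scope.
Local Open Scope ring_scope.

Set Implicit Arguments.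
Unset Strict Implicit.
Unset Printing Implicit Defensive.

(** Write D for the divergence of phi, A for the flux, b = grad u_h, a = grad v_h,
    e = grad u, and p for the vector with A p = Pi r_h; all of them are fields on
    the domain, and A b = Pi q_h, A e = q almost everywhere.

    The error identity. Duality turns the divergence of the conjugate into a
    divergence of phi with exchanged arguments, D*(A p, A b) = D(b, p)
    ([bregman_conjugate]), and the Fenchel-Young gap into D(a, p) ([young_gap]).
    The three-point identity reads
    D(a, b) + D(b, p) = D(a, p) + (A p - A b).(a - b), so everything rests on the
    integral of the last product being zero. It is: on each cell a - b is
    constant, so the means Pi r_h - Pi q_h may be replaced by r_h - q_h, a
    divergence-free Raviart-Thomas field without normal trace on the Neumann
    boundary, and discrete integration by parts applies
    ([discrete_orthogonality]). This needs the open cells to be disjoint and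
    contained in the domain, which follows from the face condition of the
    triangulation and from the Lipschitz boundary, respectively.

    The equivalence. The lower bound holds with the constant 1, as u_h and q_h
    compete in the two infima. For the upper bound, D is a quasi-metric whose
    constants depend only on those of uniform convexity: D(a, b) is comparable,
    from both sides, to w(max(|a|, |b|)) |a - b|^2 with w(t) = phi'(t) / t
    ([breg_le_quad], [breg_ge_quad]), which is symmetric and satisfies a
    quasi-triangle inequality ([quad_triangle]). Hence the error, the integral of
    D(b, e) + D(e, b), is at most a multiple of that of D(a, b) + D(a, e). By the
    identity the integral of D(a, b) is at most that of D(a, p), and D(a, p) is
    at most a multiple of D(a, e) + D(e, p) = D(a, e) + D*(Pi r_h, q)
    ([quasi_optimal]).

    The conjugate enters only through its values and its derivative at slopes
    of phi: uniform convexity makes phi' a continuous bijection of the half-line,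
    and the derivative of the conjugate is its inverse ([rderiv_conjugate]). *)

(** * Growth of the derivative of a uniformly convex N-function *)

Section growth.
Context {R : realType}.
Variables (ph : R -> R) (c C : R).
Hypotheses (c0 : 0 < c) (C0 : 0 < C).
Hypothesis ph0 : ph 0 = 0.
Hypothesis ph_gt0 : forall s, 0 < s -> 0 < ph s.
Hypothesis ph_nd : forall s t, 0 <= s -> s <= t -> ph s <= ph t.
Hypothesis ph_uc : forall t s, 0 <= t -> t < s ->
  c * ((ph s - ph t) / (s - t)) <= ph s / s /\
  ph s / s <= C * ((ph s - ph t) / (s - t)).

(** Uniform convexity says that this quotient is comparable to the difference
    quotients of [ph], so it plays the part of a second derivative. *)
Definition weight t := ph t / t.

Lemma weightE t : 0 <= t -> weight t * t = ph t.
Proof.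
rewrite le_eqVlt => /predU1P[<-|t0]; first by rewrite mulr0 ph0.
by rewrite /weight divfK// gt_eqF.
Qed.

Lemma weight_ge0 t : 0 <= t -> 0 <= weight t.
Proof.
rewrite le_eqVlt => /predU1P[<-|t0]; first by rewrite /weight ph0 mul0r.
by rewrite divr_ge0// ltW// ph_gt0.
Qed.

(** For t = 0 the difference quotient of [ph] is [ph s / s] itself, which
    forces [c <= 1 <= C]. *)
Lemma uc_le1 : c <= 1.
Proof.
have [+ _] := ph_uc (lexx 0) (@ltr01 R).
rewrite ph0 !subr0 divr1 => h; have := ph_gt0 (@ltr01 R) => h1.
by rewrite -(ler_pM2r h1) mul1r.
Qed.

Lemma uc_ge1 : 1 <= C.
Proof.
have [_ +] := ph_uc (lexx 0) (@ltr01 R).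
rewrite ph0 !subr0 divr1 => h; have := ph_gt0 (@ltr01 R) => h1.
by rewrite -(ler_pM2r h1) mul1r.
Qed.

Lemma increment_le t s : 0 <= t -> t <= s ->
  c * (ph s - ph t) <= weight s * (s - t).
Proof.
move=> t0; rewrite le_eqVlt => /predU1P[->|ts]; first by rewrite !subrr !mulr0.
have st0 : 0 < s - t by rewrite subr_gt0.
by have [+ _] := ph_uc t0 ts; rewrite mulrA ler_pdivrMr.
Qed.

Lemma increment_ge t s : 0 <= t -> t <= s ->
  weight s * (s - t) <= C * (ph s - ph t).
Proof.
move=> t0; rewrite le_eqVlt => /predU1P[->|ts]; first by rewrite !subrr !mulr0.
have st0 : 0 < s - t by rewrite subr_gt0.
by have [_ +] := ph_uc t0 ts; rewrite mulrA ler_pdivlMr.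
Qed.

Lemma weightM_le s t : 0 <= s -> s <= t -> weight s * s <= weight t * t.
Proof.
by move=> s0 st; rewrite !weightE ?(le_trans s0 st)//; exact: ph_nd.
Qed.

(** Over a step of relative length at most [c / 2], uniform convexity lets [ph]
    lose at most half of its value; this takes the place of a doubling
    condition. *)
Lemma weight_doubling s t : 0 <= t -> (1 - c / 2) * s <= t -> t <= s ->
  weight s <= 2 * weight t.
Proof.
move=> t0 st ts; have c1 := uc_le1.
have s0 : 0 <= s := le_trans t0 ts.
move: s0; rewrite le_eqVlt => /predU1P[s0|s0].
  have -> : t = s by apply/eqP; rewrite eq_le ts -s0.
  by have := @weight_ge0 s; rewrite -s0 => /(_ (lexx _)); lra.
have t1 : 0 < t by nra.
have h := increment_le t0 ts.
have ws := weightE (ltW s0); have wt := weightE t0.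
have w0 := weight_ge0 (ltW s0).
have h1 : weight s * (s - t) <= c / 2 * (weight s * s) by nra.
have h2 : ph s <= 2 * ph t.
  rewrite -(ler_pM2l c0); rewrite ws in h1; lra.
rewrite -(ler_pM2r t1) -(mulrA 2) wt; apply: le_trans h2.
by rewrite -ws ler_wpM2l.
Qed.

(** For two vectors of lengths [s] and [t] at squared distance [d], a quantity
    comparable to their Bregman divergence in either order, but symmetric by
    construction. *)
Definition quad (s t d : R) : R := weight (Num.max s t) * d.

Lemma quadC s t d : quad s t d = quad t s d.
Proof. by rewrite /quad maxC. Qed.

(** The weight may decrease, but [t * weight t] does not: passing from [r] to a
    larger length [m] costs a factor 4 while [m <= 4 * r], and beyond that the
    distance [d] is itself of the size of [m]. *)
Lemma weight_far r m z d : 0 <= r -> r <= m -> 0 <= z -> z <= 2 * d ->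
  m - r <= d -> z <= 2 * r -> weight r * z ^+ 2 <= 16 * (weight m * d ^+ 2).
Proof.
move=> r0 rm z0 zd mrd zr.
have m0 := le_trans r0 rm.
have wr := weight_ge0 r0; have wm := weight_ge0 m0.
have wrm := weightM_le r0 rm.
have d0 : 0 <= d by lra.
have zd2 : z ^+ 2 <= 4 * d ^+ 2 by nra.
move: m0; rewrite le_eqVlt => /predU1P[m0|m0].
  have r0' : r = m by apply/eqP; rewrite eq_le rm -m0.
  rewrite r0'; nra.
have [m4|m4] := leP m (4 * r).
  have h : weight r <= 4 * weight m.
    rewrite -(ler_pM2r m0).
    have : weight r * m <= weight r * (4 * r) by rewrite ler_wpM2l.
    lra.
  have -> : 16 * (weight m * d ^+ 2) = (4 * weight m) * (4 * d ^+ 2) by ring.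
  by rewrite ler_pM// sqr_ge0.
have h1 : (3/4) * m <= d by lra.
have h2 : (9/16) * m ^+ 2 <= d ^+ 2 by nra.
have h3 : z ^+ 2 <= 4 * r ^+ 2 by nra.
have h4 : weight m * ((9/16) * m ^+ 2) <= weight m * d ^+ 2 by rewrite ler_wpM2l.
have h5 : weight r * z ^+ 2 <= weight r * (4 * r ^+ 2) by rewrite ler_wpM2l.
have h6 : (weight r * r) * r <= (weight m * m) * m.
  by rewrite ler_pM// mulr_ge0.
nra.
Qed.

(** One of the two steps covers half of the distance [z]. If its larger length is
    at least about [r], its weight controls that of [r]; otherwise the
    intermediate length [m] is far below [r], and then the first step alone has
    the size of [r]. *)
Lemma quad_triangle_le r m l x y z : 0 <= l -> l <= r -> 0 <= m ->
  0 <= z -> z <= x + y -> `|r - m| <= x -> `|m - l| <= y -> z <= r + l ->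
  weight r * z ^+ 2 <= 16 / c ^+ 2 * (quad r m (x ^+ 2) + quad m l (y ^+ 2)).
Proof.
move=> l0 lr m0 z0 zxy /ler_normlP[rmx1 rmx2] /ler_normlP[mly1 mly2] zrl.
have c1 := uc_le1.
have r0 := le_trans l0 lr.
have wr := weight_ge0 r0.
have qx0 : 0 <= quad r m (x ^+ 2).
  by rewrite mulr_ge0 ?sqr_ge0// weight_ge0// le_max r0.
have qy0 : 0 <= quad m l (y ^+ 2).
  by rewrite mulr_ge0 ?sqr_ge0// weight_ge0// le_max m0.
have c2 : 1 <= (c ^+ 2)^-1.
  by rewrite -[leLHS]invr1 lef_pV2 ?posrE ?ltr01 ?exprn_gt0// exprn_ile1// ltW.
set k := 16 / c ^+ 2.
have k16 : 16 <= k by rewrite /k; lra.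
suff : weight r * z ^+ 2 <= k * quad r m (x ^+ 2) \/
       weight r * z ^+ 2 <= k * quad m l (y ^+ 2).
  have hx : 0 <= k * quad r m (x ^+ 2) by rewrite mulr_ge0//; lra.
  have hy : 0 <= k * quad m l (y ^+ 2) by rewrite mulr_ge0//; lra.
  by rewrite mulrDr; case; lra.
have bx : forall A, A <= 16 * quad r m (x ^+ 2) -> A <= k * quad r m (x ^+ 2).
  by move=> A hA; apply: (le_trans hA); rewrite ler_wpM2r.
have bY : forall A, A <= 16 * quad m l (y ^+ 2) -> A <= k * quad m l (y ^+ 2).
  by move=> A hA; apply: (le_trans hA); rewrite ler_wpM2r.
have [rm|mr] := leP r m.
  have [xz|xz] := leP z (2 * x).
    left; apply: bx; rewrite /quad max_r//.
    by apply: weight_far => //; lra.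
  right; apply: bY; rewrite /quad max_l; last exact: le_trans rm.
  by apply: weight_far => //; lra.
have [xz|xz] := leP z (2 * x).
  left; apply: bx; rewrite /quad max_l ?(ltW mr)// [leRHS]mulrCA ler_wpM2l//.
  have x0 : 0 <= x by lra.
  nra.
have [rho|rho] := leP ((1 - c / 2) * r) (Num.max m l).
  right; apply: bY; rewrite /quad.
  have rho0 : 0 <= Num.max m l by rewrite le_max m0.
  have rhor : Num.max m l <= r by rewrite ge_max (ltW mr) lr.
  have := weight_doubling rho0 rho rhor; have := weight_ge0 rho0.
  set W := weight (Num.max m l) => W0 hW.
  have yz : z ^+ 2 <= 4 * y ^+ 2 by nra.
  have -> : 16 * (W * y ^+ 2) = (4 * W) * (4 * y ^+ 2) by ring.
  by rewrite ler_pM ?sqr_ge0//; lra.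
left; rewrite /quad max_l ?(ltW mr)//.
have mrho : m < (1 - c / 2) * r by apply: le_lt_trans rho; rewrite le_max lexx.
have hx : c * z <= 4 * x by nra.
have h : c ^+ 2 * z ^+ 2 <= 16 * x ^+ 2.
  have : 0 <= c * z by rewrite mulr_ge0// ltW.
  nra.
have -> : k * (weight r * x ^+ 2) = weight r * (16 * x ^+ 2 / c ^+ 2).
  by rewrite /k; ring.
by rewrite ler_wpM2l// ler_pdivlMr ?exprn_gt0// mulrC.
Qed.

Lemma quad_triangle r m l x y z : 0 <= r -> 0 <= l -> 0 <= m ->
  0 <= z -> z <= x + y -> `|r - m| <= x -> `|m - l| <= y -> z <= r + l ->
  quad r l (z ^+ 2) <= 16 / c ^+ 2 * (quad r m (x ^+ 2) + quad m l (y ^+ 2)).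
Proof.
move=> r0 l0 m0 z0 zxy rmx mly zrl.
have [lr|rl] := leP l r.
  by rewrite {1}/quad max_l//; exact: quad_triangle_le.
rewrite {1}/quad max_r ?(ltW rl)// addrC (quadC m) (quadC r).
apply: quad_triangle_le => //; first exact: ltW.
- by rewrite addrC.
- by rewrite distrC.
- by rewrite distrC.
- by rewrite addrC.
Qed.

Variable phi : R -> R.
Hypothesis phi_sub : forall s t, 0 <= s -> 0 <= t ->
  phi t + ph t * (s - t) <= phi s.

Definition sbreg s t := phi s - phi t - ph t * (s - t).

Lemma sbreg_le s t : 0 <= s -> 0 <= t ->
  c * sbreg s t <= quad s t ((s - t) ^+ 2).
Proof.
move=> s0 t0.
have h1 : sbreg s t <= (ph s - ph t) * (s - t).
  by have := phi_sub t0 s0; rewrite /sbreg; lra.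
apply: (@le_trans _ _ (c * ((ph s - ph t) * (s - t)))).
  by rewrite ler_wpM2l// ltW.
rewrite /quad; have [ts|st] := leP t s.
  by rewrite mulrA expr2 mulrA ler_wpM2r ?subr_ge0//; exact: increment_le.
rewrite -(sqrrN (s - t)) opprB.
have -> : c * ((ph s - ph t) * (s - t)) = c * (ph t - ph s) * (t - s) by ring.
rewrite expr2 mulrA ler_wpM2r ?subr_ge0 ?(ltW st)//.
exact: increment_le (ltW st).
Qed.

(** Convexity at a point [m] between [t] and [s] bounds the divergence below by
    [(ph m - ph t) * (s - m)]. For [t <= s] the point is taken so close to [s]
    that the weights at [m] and [s] are comparable; for [s < t] the midpoint
    will do. *)
Lemma sbreg_ge s t : 0 <= s -> 0 <= t ->
  c * quad s t ((s - t) ^+ 2) <= 8 * C * sbreg s t.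
Proof.
move=> s0 t0; have c1 := uc_le1; have C1 := uc_ge1.
have D0 : 0 <= sbreg s t by have := phi_sub s0 t0; rewrite /sbreg; lra.
have split_at m : 0 <= m -> (ph m - ph t) * (s - m) <= sbreg s t.
  move=> m0; have := phi_sub s0 m0; have := phi_sub m0 t0; rewrite /sbreg; nra.
rewrite /quad; have [ts|st] := leP t s.
  pose m := s - c / 2 * (s - t).
  have st0 : 0 <= s - t by rewrite subr_ge0.
  have cst : 0 <= c * (s - t) by rewrite mulr_ge0// ltW.
  have cst1 : c * (s - t) <= s - t by rewrite -[leRHS]mul1r ler_wpM2r.
  have ct : 0 <= c * t by rewrite mulr_ge0// ltW.
  have tm : t <= m by rewrite /m; lra.
  have ms : m <= s by rewrite /m; lra.
  have m0 := le_trans t0 tm.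
  have hw : weight s <= 2 * weight m.
    by apply: weight_doubling => //; rewrite /m; lra.
  have h := increment_ge t0 tm.
  have h2 := split_at _ m0.
  have w0 := weight_ge0 m0.
  have h3 : (m - t) * weight m * (s - m) <= C * sbreg s t.
    apply: (@le_trans _ _ (C * ((ph m - ph t) * (s - m)))).
      by rewrite mulrA ler_wpM2r ?subr_ge0// mulrC.
    by rewrite ler_wpM2l// ltW.
  have e1 : s - m = c / 2 * (s - t) by rewrite /m; ring.
  have e2 : (s - t) / 2 <= m - t by rewrite /m; lra.
  have h4 : (s - t) / 2 * weight m * (c / 2 * (s - t)) <= C * sbreg s t.
    apply: le_trans h3; rewrite e1 -!(mulrA _ (weight m)) ler_wpM2r//.
    by rewrite mulr_ge0// mulr_ge0// divr_ge0// ltW.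
  have h5 : c * (weight s * (s - t) ^+ 2) <= c * (2 * weight m * (s - t) ^+ 2).
    by rewrite ler_wpM2l ?(ltW c0)// ler_wpM2r// sqr_ge0.
  nra.
pose m := (s + t) / 2.
have sm : s <= m by rewrite /m; lra.
have mt : m <= t by rewrite /m; lra.
have m0 := le_trans s0 sm.
have h := increment_ge m0 mt.
have h2 := split_at _ m0.
have h3 : weight t * (t - m) * (m - s) <= C * sbreg s t.
  apply: (@le_trans _ _ (C * ((ph m - ph t) * (s - m)))).
    have -> : C * ((ph m - ph t) * (s - m)) = C * (ph t - ph m) * (m - s) by ring.
    by rewrite ler_wpM2r ?subr_ge0.
  by rewrite ler_wpM2l// ltW.
have e : weight t * (t - m) * (m - s) = weight t * (s - t) ^+ 2 / 4.
  by rewrite /m; field.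
rewrite e in h3.
have q0 : 0 <= weight t * (s - t) ^+ 2 by rewrite mulr_ge0 ?sqr_ge0// weight_ge0.
have : c * (weight t * (s - t) ^+ 2) <= weight t * (s - t) ^+ 2.
  by rewrite -[leRHS]mul1r ler_wpM2r.
have : 0 <= C * sbreg s t by rewrite mulr_ge0// ltW.
lra.
Qed.

(** [P] stands for the defect |a||b| - a.b of two vectors of lengths [s] and
    [t], whose squared distance is [(s - t) ^+ 2 + 2 * P]. The bound is a matter
    of replacing [weight t] by the weight at the larger length. *)
Lemma breg_le_quad s t P : 0 <= s -> 0 <= t -> 0 <= P -> P <= 2 * (s * t) ->
  sbreg s t + weight t * P <= (c^-1 + 8) * quad s t ((s - t) ^+ 2 + 2 * P).
Proof.
move=> s0 t0 P0 Pst; have c1 := uc_le1.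
have h1 : sbreg s t <= c^-1 * quad s t ((s - t) ^+ 2).
  by rewrite mulrC ler_pdivlMr// mulrC; exact: sbreg_le.
have ci : 0 <= c^-1 by rewrite invr_ge0 ltW.
have wt := weight_ge0 t0.
have m0 : 0 <= Num.max s t by rewrite le_max s0.
have W0 := weight_ge0 m0.
have q0 : 0 <= c^-1 * (weight (Num.max s t) * P) by rewrite mulr_ge0// mulr_ge0.
suff : weight t * P <= 8 * quad s t ((s - t) ^+ 2 + 2 * P).
  by move: h1 q0; rewrite /quad; lra.
have qs : 0 <= weight (Num.max s t) * (s - t) ^+ 2 by rewrite mulr_ge0// sqr_ge0.
have qP : 0 <= weight (Num.max s t) * P by rewrite mulr_ge0.
move: qs qP; rewrite /quad; have [ts|st] := leP t s; last first.
  by lra.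
have wst := weightM_le t0 ts; have ws := weight_ge0 s0.
have [t2|t2] := leP s (2 * t).
  move=> qs qP.
  suff : weight t * P <= 2 * (weight s * P) by lra.
  have [->|P1] := eqVneq P 0; first by rewrite !mulr0.
  have t1 : 0 < t.
    rewrite lt_neqAle t0 andbT; apply: contra P1 => /eqP t1.
    by rewrite -t1 !mulr0 in Pst; rewrite eq_le Pst P0.
  have : weight t <= 2 * weight s.
    rewrite -(ler_pM2r t1); apply: (le_trans wst).
    have : weight s * s <= weight s * (2 * t) by rewrite ler_wpM2l.
    lra.
  by move=> hw; rewrite mulrA ler_wpM2r.
move=> qs qP.
have h2 : weight t * P <= weight t * (2 * (s * t)) by rewrite ler_wpM2l.
have h3 : (weight t * t) * s <= (weight s * s) * s by rewrite ler_wpM2r.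
have h4 : weight s * s ^+ 2 <= weight s * (4 * (s - t) ^+ 2).
  by rewrite ler_wpM2l//; nra.
nra.
Qed.

(** The angular term comes with [weight t] only. If [t] is far below [s], this may
    be too small, but then [P <= 2 * (s * t)] is dominated by [(s - t) ^+ 2] and
    the radial term is enough. *)
Lemma breg_ge_quad s t P : 0 <= s -> 0 <= t -> 0 <= P -> P <= 2 * (s * t) ->
  c ^+ 3 / (136 * C) * quad s t ((s - t) ^+ 2 + 2 * P) <=
  sbreg s t + weight t * P.
Proof.
move=> s0 t0 P0 Pst; have c1 := uc_le1; have C1 := uc_ge1.
rewrite mulrAC ler_pdivrMr; last by rewrite mulr_gt0.
have h1 := sbreg_ge s0 t0.
have wt := weight_ge0 t0.
have m0 : 0 <= Num.max s t by rewrite le_max s0.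
have W0 := weight_ge0 m0.
have qs : 0 <= weight (Num.max s t) * (s - t) ^+ 2 by rewrite mulr_ge0// sqr_ge0.
have qP : 0 <= weight (Num.max s t) * P by rewrite mulr_ge0.
have c2 : 0 <= c ^+ 2 by rewrite sqr_ge0.
have c21 : c ^+ 2 <= 1 by rewrite exprn_ile1// ltW.
have wtP : 0 <= weight t * P by rewrite mulr_ge0.
have c32 : c ^+ 3 <= c by rewrite exprS -[leRHS]mulr1 ler_wpM2l// ltW.
have c31 : c ^+ 3 <= 1 by lra.
have D0 : 0 <= sbreg s t by have := phi_sub s0 t0; rewrite /sbreg; lra.
have CD : 0 <= C * sbreg s t by rewrite mulr_ge0// ltW.
have CP : weight t * P <= C * (weight t * P).
  by rewrite -[leLHS]mul1r ler_wpM2r.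
have near_case : weight (Num.max s t) <= 2 * weight t ->
  c ^+ 3 * quad s t ((s - t) ^+ 2 + 2 * P) <=
  (sbreg s t + weight t * P) * (136 * C).
  move=> hw.
  have h2 : weight (Num.max s t) * P <= 2 * (weight t * P).
    by rewrite mulrA ler_wpM2r.
  have h3 : c ^+ 3 * (weight (Num.max s t) * P) <= weight (Num.max s t) * P.
    by rewrite -[leRHS]mul1r ler_wpM2r.
  have h4 : c ^+ 3 * (weight (Num.max s t) * (s - t) ^+ 2) <=
            c * (weight (Num.max s t) * (s - t) ^+ 2).
    by rewrite ler_wpM2r.
  move: h1; rewrite /quad; lra.
have [tm|tm] := leP ((1 - c / 2) * Num.max s t) t.
  by apply: near_case; apply: weight_doubling => //; rewrite le_max lexx orbT.
have st : t < s.
  rewrite ltNge; apply/negP => st; move: tm; rewrite max_r//.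
  by have := mulr_ge0 (ltW c0) t0; lra.
rewrite /quad max_l ?(ltW st)// in tm h1 qs qP W0 *.
have h2 : c * s <= 2 * (s - t) by lra.
have h3 : c ^+ 2 * s ^+ 2 <= 4 * (s - t) ^+ 2.
  have : 0 <= c * s by rewrite mulr_ge0// ltW.
  nra.
have h4 : P <= 2 * s ^+ 2 by nra.
have h5 : c ^+ 2 * P <= 8 * (s - t) ^+ 2 by nra.
have h6 : c ^+ 2 * ((s - t) ^+ 2 + 2 * P) <= 17 * (s - t) ^+ 2.
  have : c ^+ 2 * (s - t) ^+ 2 <= (s - t) ^+ 2.
    by rewrite -[leRHS]mul1r ler_wpM2r// sqr_ge0.
  lra.
have h7 : c * weight s * (c ^+ 2 * ((s - t) ^+ 2 + 2 * P)) <=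
          c * weight s * (17 * (s - t) ^+ 2).
  by rewrite ler_wpM2l// mulr_ge0// ltW.
have -> : c ^+ 3 * (weight s * ((s - t) ^+ 2 + 2 * P)) =
  c * weight s * (c ^+ 2 * ((s - t) ^+ 2 + 2 * P)) by ring.
have : 0 <= C * (weight t * P) by rewrite mulr_ge0// ltW.
lra.
Qed.

End growth.

(** * The conjugate of a uniformly convex N-function *)

Section Nfunction.
Context {R : realType}.
Variables (phi : R -> R) (c C : R).
Hypotheses (c0 : 0 < c) (C0 : 0 < C).
Hypotheses (hN : is_Nfunction phi) (hU : uniformly_convex c C phi).
Let ph := rderiv phi.

Lemma rderiv0 : rderiv phi 0 = 0.
Proof. by have [_ _ _ _ []] := hN. Qed.

Lemma rderiv_gt0 s : 0 < s -> 0 < rderiv phi s.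
Proof. by have [_ _ _ _ [_ _ _ + _]] := hN; exact. Qed.

Lemma rderiv_nd s t : 0 <= s -> s <= t -> rderiv phi s <= rderiv phi t.
Proof. by have [_ _ _ _ [_ + _ _ _]] := hN; exact. Qed.

Lemma rderiv_ge0 s : 0 <= s -> 0 <= rderiv phi s.
Proof. by move=> s0; rewrite -rderiv0 rderiv_nd. Qed.

(** The monotone derivative is integrated over the interval between [s] and
    [t]. *)
Lemma Nfunction_subgradient s t : 0 <= s -> 0 <= t ->
  phi t + rderiv phi t * (s - t) <= phi s.
Proof.
move=> s0 t0; have [_ _ _ phiE _] := hN.
have ph_int a : 0 <= a ->
    (@lebesgue_measure R).-integrable `[0, a] (EFin \o ph).
  move=> a0; apply: measurable_bounded_integrable => //.
  - by rewrite /= lebesgue_measure_itv/= lte_fin; case: ifP; rewrite -?EFinB ltry.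
  - have : measurable_fun `[0, a] (fun x : R => ph (Num.max 0 x)).
      apply: nondecreasing_measurable => // x y xy.
      apply: rderiv_nd; first by rewrite le_max lexx.
      by rewrite ge_max !le_max lexx xy orbT.
    apply: eq_measurable_fun => x.
    by rewrite inE/= in_itv/= => /andP[x0 _]; rewrite max_r.
  - exists (ph a); split; first exact: num_real.
    move=> k ak x; rewrite /= in_itv/= => /andP[x0 xa].
    by rewrite ger0_norm ?rderiv_ge0// (le_trans _ (ltW ak))// rderiv_nd.
have increment a b : 0 <= a -> a <= b ->
    phi b - phi a = \int[lebesgue_measure]_(x in `]a, b]) ph x.
  move=> a0 ab; have b0 := le_trans a0 ab.
  by rewrite phiE// [in X in _ - X]phiE// Rintegral_itvB//; exact: ph_int.
have mass a b : a <= b -> fine (lebesgue_measure `]a, b]%classic) = b - a.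
  move=> ab; rewrite /= lebesgue_measure_itv/= lte_fin; case: ltP => // ba.
  by rewrite (_ : a = b) ?subrr//; apply/eqP; rewrite eq_le ab.
have cst_int a b r : (@lebesgue_measure R).-integrable `]a, b] (EFin \o cst r).
  apply: measurable_bounded_integrable => //.
  - by rewrite /= lebesgue_measure_itv/= lte_fin; case: ifP; rewrite -?EFinB ltry.
  - by exists `|r|; split; [exact: num_real|move=> k rk x _; exact: ltW].
have ph_int' a b : 0 <= a -> 0 <= b ->
    (@lebesgue_measure R).-integrable `]a, b] (EFin \o ph).
  move=> a0 b0; apply: integrableS (ph_int b b0) => //.
  by apply: subset_itvr; rewrite bnd_simp.
have [ts|st] := leP t s.
  rewrite -lerBrDl increment// -mass// -Rintegral_cst//.
  apply: le_Rintegral => //; [exact: cst_int|exact: ph_int'|].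
  by move=> x; rewrite /= in_itv/= => /andP[tx _]; rewrite rderiv_nd// ltW.
suff : phi t - phi s <= ph t * (t - s) by rewrite /ph; lra.
rewrite increment ?(ltW st)// -mass ?(ltW st)// -Rintegral_cst//.
apply: le_Rintegral => //; [exact: ph_int'|exact: cst_int|].
move=> x; rewrite /= in_itv/= => /andP[sx xt].
by rewrite rderiv_nd// (le_trans s0)// ltW.
Qed.

Lemma Nfunction_nd s t : 0 <= s -> s <= t -> phi s <= phi t.
Proof.
move=> s0 st; have := Nfunction_subgradient (le_trans s0 st) s0.
by apply: le_trans; rewrite lerDl mulr_ge0 ?subr_ge0// rderiv_ge0.
Qed.

Lemma rderiv_strict t s : 0 <= t -> t < s -> rderiv phi t < rderiv phi s.
Proof.
move=> t0 ts; have s0 := le_lt_trans t0 ts.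
have := increment_ge hU t0 (ltW ts).
rewrite -subr_gt0 -(pmulr_rgt0 _ C0); apply: lt_le_trans.
by rewrite mulr_gt0 ?subr_gt0// divr_gt0// rderiv_gt0.
Qed.

(** At the supremum [s] of the points where the derivative is at most [y], right
    continuity gives [y <= rderiv phi s]; a jump at [s] from below is excluded by
    uniform convexity, which bounds the left increments of the derivative
    linearly. *)
Lemma rderiv_onto y : 0 <= y -> exists2 s, 0 <= s & rderiv phi s = y.
Proof.
move=> y0; have [_ _ _ _ [ph_rc _ _ _ ph_oo]] := hN.
pose E := [set s | 0 <= s /\ ph s <= y].
have E0 : E 0 by split=> //; rewrite /ph rderiv0.
have [A [_ HA]] : \forall s \near +oo, y < ph s by move/cvgryPgt : ph_oo; exact.
have Eub : ubound E A.
  move=> s [s0 sy]; rewrite leNgt; apply/negP => /HA.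
  by rewrite ltNge sy.
have hE : has_sup E by split; [exists 0|exists A].
pose s := sup E.
have s_ub : ubound E s := sup_upper_bound hE.
have s0 : 0 <= s := s_ub _ E0.
exists s => //; apply/eqP; rewrite eq_le; apply/andP; split; last first.
  have := ph_rc _ s0; move=> /cvgr_to_ge; apply; near=> x.
  have xs : s < x by near: x; exact: nbhs_right_gt.
  rewrite leNgt; apply/negP => xy; move: (xs); rewrite ltNge => /negP; apply.
  by apply: s_ub; split; [exact: le_trans s0 (ltW xs)|exact: ltW].
rewrite leNgt; apply/negP => ys.
have s1 : 0 < s.
  rewrite lt_neqAle s0 andbT; apply/eqP => s1; move: ys.
  by rewrite -s1 rderiv0 ltNge y0.
have w0 : 0 < weight ph s by rewrite divr_gt0// rderiv_gt0.
pose eps := c * (ph s - y) / weight ph s.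
have eps0 : 0 < eps by rewrite divr_gt0// mulr_gt0// subr_gt0.
have [t [t0 ty]] := sup_adherent eps0 hE; rewrite -/s => st.
have ts : t <= s by apply: s_ub.
have h := increment_le hU t0 ts.
have : s - t < eps by rewrite ltrBlDr addrC -ltrBlDr.
rewrite /eps ltr_pdivlMr// => h2.
have : c * (ph s - y) <= c * (ph s - ph t) by rewrite ler_pM2l// lerB.
by move: h h2; rewrite /ph; lra.
Unshelve. all: by end_near. Qed.

(** By the subgradient inequality the supremum over [r] of
    [r * rderiv phi s - phi r] is attained at [r = s]. *)
Lemma conjugate_rderiv s : 0 <= s ->
  conjugate phi (rderiv phi s) = s * rderiv phi s - phi s.
Proof.
move=> s0; have ub : ubound [set r * rderiv phi s - phi r | r in [set r | 0 <= r]]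
    (s * rderiv phi s - phi s).
  by move=> _ [r /= r0 <-]; have := Nfunction_subgradient r0 s0; lra.
have mem : [set r * rderiv phi s - phi r | r in [set r | 0 <= r]]
    (s * rderiv phi s - phi s) by exists s.
apply/eqP; rewrite eq_le; apply/andP; split.
- by apply: ge_sup => //; exists (s * rderiv phi s - phi s).
- by apply: ub_le_sup => //; exists (s * rderiv phi s - phi s).
Qed.

(** Between the slopes at [s] and at [r > s], the difference quotient of the
    conjugate lies between [s] and [r]; and [r] tends to [s] as the slopes
    approach each other because the derivative is strictly increasing. *)
Lemma rderiv_conjugate s : 0 <= s -> rderiv (conjugate phi) (rderiv phi s) = s.
Proof.
move=> s0; apply: cvg_lim => //; apply/cvgrPdist_le => e e0.
have gap : 0 < ph (s + e) - ph s.
  by rewrite subr_gt0 rderiv_strict// ltrDl.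
near=> h.
have h0 : 0 < h by near: h; exact: nbhs_right_gt.
have hg : h < ph (s + e) - ph s by near: h; exact: nbhs_right_lt.
have phs0 : 0 <= ph s by exact: rderiv_ge0.
have [r r0 rE] := @rderiv_onto (ph s + h) (addr_ge0 phs0 (ltW h0)).
have se0 : 0 <= s + e by rewrite addr_ge0// ltW.
have rse : r <= s + e.
  rewrite leNgt; apply/negP => ser.
  have := rderiv_nd se0 (ltW ser); rewrite rE.
  by move: hg; rewrite /ph; lra.
rewrite -/ph -rE conjugate_rderiv// conjugate_rderiv// rE.
have h1 := Nfunction_subgradient r0 s0; have h2 := Nfunction_subgradient s0 r0.
rewrite rE in h2.
set Q := h^-1 * _.
have QE : Q * h = r * (ph s + h) - phi r - (s * ph s - phi s).
  by rewrite /Q mulrC mulrA divff ?mul1r ?gt_eqF.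
have sQ : s <= Q by rewrite -(ler_pM2r h0) QE; lra.
have Qr : Q <= r by rewrite -(ler_pM2r h0) QE; move: h1; rewrite -/ph; lra.
by rewrite ler_norml; lra.
Unshelve. all: by end_near. Qed.

Lemma rderiv_conjugate_nd s t : 0 <= s -> s <= t ->
  rderiv (conjugate phi) s <= rderiv (conjugate phi) t.
Proof.
move=> s0 st; have t0 := le_trans s0 st.
have [r r0 rE] := rderiv_onto s0; have [r' r'0 r'E] := rderiv_onto t0.
rewrite -rE -r'E !rderiv_conjugate// leNgt; apply/negP => /(rderiv_strict r'0).
by rewrite rE r'E ltNge st.
Qed.

Lemma conjugate_nd s t : 0 <= s -> s <= t -> conjugate phi s <= conjugate phi t.
Proof.
move=> s0 st; have t0 := le_trans s0 st.
have [r r0 rE] := rderiv_onto s0; have [r' r'0 r'E] := rderiv_onto t0.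
rewrite -rE -r'E !conjugate_rderiv// r'E rE.
have := Nfunction_subgradient r0 r'0; rewrite r'E.
have : r * s <= r * t by rewrite ler_wpM2l.
lra.
Qed.

End Nfunction.

(** * Euclidean norm and Bregman divergences of vectors *)

Section euclidean_theory.
Context {R : realType} {n : nat}.
Implicit Types (x y z : 'rV[R]_n) (k : R).

Lemma dotC x y : dot x y = dot y x.
Proof. by apply: eq_bigr => j _; rewrite mulrC. Qed.

Lemma dotDl x y z : dot (x + y) z = dot x z + dot y z.
Proof. by rewrite -big_split; apply: eq_bigr => j _; rewrite mxE mulrDl. Qed.

Lemma dotZl k x y : dot (k *: x) y = k * dot x y.
Proof. by rewrite mulr_sumr; apply: eq_bigr => j _; rewrite mxE mulrA. Qed.

Lemma dotNl x y : dot (- x) y = - dot x y.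
Proof. by rewrite -scaleN1r dotZl mulN1r. Qed.

Lemma dotBl x y z : dot (x - y) z = dot x z - dot y z.
Proof. by rewrite dotDl dotNl. Qed.

Lemma dotDr x y z : dot z (x + y) = dot z x + dot z y.
Proof. by rewrite dotC dotDl !(dotC z). Qed.

Lemma dotZr k x y : dot x (k *: y) = k * dot x y.
Proof. by rewrite dotC dotZl dotC. Qed.

Lemma dotBr x y z : dot z (x - y) = dot z x - dot z y.
Proof. by rewrite dotC dotBl !(dotC z). Qed.

Lemma dot0l x : dot 0 x = 0.
Proof. by rewrite -(scale0r x) dotZl mul0r. Qed.

Lemma dotxx_ge0 x : 0 <= dot x x.
Proof. by apply: sumr_ge0 => j _; rewrite -expr2 sqr_ge0. Qed.

Lemma enorm_ge0 x : 0 <= enorm x.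
Proof. exact: sqrtr_ge0. Qed.

Lemma enorm_sqr x : enorm x ^+ 2 = dot x x.
Proof. by rewrite sqr_sqrtr// dotxx_ge0. Qed.

Lemma enorm0 : enorm (0 : 'rV[R]_n) = 0.
Proof. by rewrite /enorm dot0l sqrtr0. Qed.

Lemma enorm_eq0 x : enorm x = 0 -> x = 0.
Proof.
move=> x0; have : dot x x = 0 by rewrite -enorm_sqr x0 expr0n.
move/psumr_eq0P => h; apply/rowP => j; rewrite mxE.
have /eqP := h (fun i _ => sqr_ge0 (x ord0 i)) j isT.
by rewrite mulf_eq0 orbb => /eqP.
Qed.

Lemma enormZ k x : enorm (k *: x) = `|k| * enorm x.
Proof. by rewrite /enorm dotZl dotZr mulrA -expr2 sqrtrM ?sqr_ge0// sqrtr_sqr. Qed.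

Lemma enormN x : enorm (- x) = enorm x.
Proof. by rewrite -scaleN1r enormZ normrN1 mul1r. Qed.

Lemma enormB x y : enorm (x - y) = enorm (y - x).
Proof. by rewrite -enormN opprB. Qed.

(** Expand the square of |y| x - |x| y. *)
Lemma cauchy_schwarz x y : dot x y <= enorm x * enorm y.
Proof.
have [x0|x0] := eqVneq (enorm x) 0.
  by rewrite (enorm_eq0 x0) dot0l enorm0 mul0r.
have [y0|y0] := eqVneq (enorm y) 0.
  by rewrite (enorm_eq0 y0) dotC dot0l enorm0 mulr0.
have xy0 : 0 < enorm x * enorm y 
  by rewrite mulr_gt0// lt_neqAle eq_sym ?x0 ?y0 enorm_ge0.
have := dotxx_ge0 (enorm y *: x - enorm x *: y).
rewrite dotBl !dotBr !dotZl !dotZr (dotC y x) -!enorm_sqr => h.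
rewrite -(ler_pM2l xy0) -subr_ge0; lra.
Qed.

Lemma cauchy_schwarzN x y : - (enorm x * enorm y) <= dot x y.
Proof. by rewrite -[dot x y]opprK -dotNl lerN2 -(enormN x) cauchy_schwarz. Qed.

Lemma enormD x y : enorm (x + y) <= enorm x + enorm y.
Proof.
rewrite -(@ler_pXn2r _ 2) ?nnegrE ?addr_ge0 ?enorm_ge0//.
rewrite enorm_sqr dotDl !dotDr (dotC y x) sqrrD -!enorm_sqr.
have := cauchy_schwarz x y; lra.
Qed.

Lemma enorm_triangle y x z : enorm (x - z) <= enorm (x - y) + enorm (y - z).
Proof. by rewrite (le_trans _ (enormD _ _))// addrA subrK. Qed.

Lemma enorm_dist x y : `|enorm x - enorm y| <= enorm (x - y).
Proof.
have := enormD (x - y) y; have := enormD (y - x) x.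
by rewrite !subrK (enormB y x) ler_norml; lra.
Qed.

Lemma enormBD x y : enorm (x - y) <= enorm x + enorm y.
Proof. by rewrite -(enormN y) enormD. Qed.

End euclidean_theory.

Section bregman_theory.
Context {R : realType}.
Variables (phi : R -> R) (c C : R).
Hypotheses (c0 : 0 < c) (C0 : 0 < C).
Hypotheses (hN : is_Nfunction phi) (hU : uniformly_convex c C phi).
Variable n : nat.
Implicit Types a b e p : 'rV[R]_n.
Local Notation ph := (rderiv phi).
Local Notation A := (@flux R n phi).
Local Notation Ainv := (@flux R n (conjugate phi)).

Lemma dot_flux_self b : dot (A b) b = ph (enorm b) * enorm b.
Proof.
rewrite dotZl -enorm_sqr expr2 mulrA; congr (_ * _).
exact/(weightE (rderiv0 hN))/enorm_ge0.
Qed.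

Lemma enorm_flux b : enorm (A b) = ph (enorm b).
Proof.
rewrite enormZ ger0_norm; last first.
  by rewrite divr_ge0 ?enorm_ge0// rderiv_ge0// enorm_ge0.
exact/(weightE (rderiv0 hN))/enorm_ge0.
Qed.

Lemma flux0 : A 0 = 0.
Proof. by rewrite /flux scaler0. Qed.

Lemma fluxK b : Ainv (A b) = b.
Proof.
rewrite {1}/flux enorm_flux (rderiv_conjugate c0 C0)//; last exact: enorm_ge0.
have [b0|b0] := eqVneq (enorm b) 0; first by rewrite (enorm_eq0 b0) flux0 scaler0.
have bgt0 : 0 < enorm b by rewrite lt_neqAle eq_sym b0 enorm_ge0.
rewrite /flux scalerA mulrA divfK ?divff ?scale1r//.
by rewrite gt_eqF// rderiv_gt0.
Qed.

Lemma fluxVK b : A (Ainv b) = b.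
Proof.
have [b0|b0] := eqVneq (enorm b) 0.
  by rewrite (enorm_eq0 b0) /flux !scaler0.
have bgt0 : 0 < enorm b by rewrite lt_neqAle eq_sym b0 enorm_ge0.
have [s s0 sE] := rderiv_onto c0 hN hU (enorm_ge0 b).
have sgt0 : 0 < s.
  rewrite lt_neqAle s0 andbT; apply/eqP => s00; move: bgt0.
  by rewrite -sE -s00 (rderiv0 hN) ltxx.
have AbE : Ainv b = (s / enorm b) *: b.
  by rewrite {1}/flux -{1}sE (rderiv_conjugate c0 C0).
have nAb : enorm (Ainv b) = s.
  rewrite AbE enormZ ger0_norm ?divfK// divr_ge0 ?enorm_ge0//.
by rewrite {1}/flux nAb sE AbE scalerA mulrA divfK ?divff ?scale1r// gt_eqF.
Qed.

(** A radial and an angular part: this is how vector estimates reduce to the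
    scalar ones. *)
Lemma bregmanE a b : bregman phi a b =
  sbreg ph phi (enorm a) (enorm b) +
  weight ph (enorm b) * (enorm a * enorm b - dot a b).
Proof.
rewrite /bregman dotBr dot_flux_self /sbreg dotZl (dotC b) -/(weight _ _).
have := weightE (rderiv0 hN) (enorm_ge0 b).
by move: (weight _ _) => w wE; rewrite -wE; ring.
Qed.

(** Duality exchanges the two arguments, so that every estimate of the divergence
    of the conjugate is one of the divergence of [phi]. *)
Lemma bregman_conjugate a b :
  bregman (conjugate phi) (A a) (A b) = bregman phi b a.
Proof.
rewrite /bregman !enorm_flux fluxK !(conjugate_rderiv hN) ?enorm_ge0// !dotBr.
rewrite (dotC b (A b)) !dot_flux_self (dotC b).
by ring.
Qed.

Lemma bregman_conjugateV a b :
  bregman (conjugate phi) a b = bregman phi (Ainv b) (Ainv a).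
Proof. by rewrite -bregman_conjugate !fluxVK. Qed.

(** The Fenchel-Young gap is itself a divergence; this opens the right-hand side
    of the error identity to the quasi-triangle inequality. *)
Lemma young_gap a b : phi (enorm a) - dot b a + conjugate phi (enorm b) =
  bregman phi a (Ainv b).
Proof.
rewrite -{1 2}(fluxVK b) enorm_flux (conjugate_rderiv hN) ?enorm_ge0//.
by rewrite /bregman dotBr dot_flux_self; ring.
Qed.

(** The cross term is the one that discrete orthogonality removes after
    integration. *)
Lemma bregman_three_points a b p : bregman phi a b + bregman phi b p =
  bregman phi a p + dot (A p - A b) (a - b).
Proof. by rewrite /bregman !dotBr !dotBl; ring. Qed.

Lemma bregman_ge0 a b : 0 <= bregman phi a b.
Proof.
have := Nfunction_subgradient hN (enorm_ge0 a) (enorm_ge0 b) => h.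
rewrite bregmanE addr_ge0//; first by rewrite /sbreg; lra.
rewrite mulr_ge0 ?subr_ge0 ?cauchy_schwarz// weight_ge0 ?enorm_ge0//.
- exact: rderiv0.
- exact: rderiv_gt0.
Qed.

Let M a b := quad ph (enorm a) (enorm b) (enorm (a - b) ^+ 2).

Let MC a b : M a b = M b a.
Proof. by rewrite /M quadC enormB. Qed.

Let sqr_dist a b : enorm (a - b) ^+ 2 =
  (enorm a - enorm b) ^+ 2 + 2 * (enorm a * enorm b - dot a b).
Proof.
by rewrite enorm_sqr dotBl !dotBr (dotC b a) -!enorm_sqr; ring.
Qed.

Let defect a b : 0 <= enorm a * enorm b - dot a b <= 2 * (enorm a * enorm b).
Proof. by have := cauchy_schwarz a b; have := cauchy_schwarzN a b; lra. Qed.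

Let breg_le a b : bregman phi a b <= (c^-1 + 8) * M a b.
Proof.
have /andP[P0 P2] := defect a b; rewrite bregmanE /M sqr_dist.
apply: breg_le_quad => //; rewrite ?enorm_ge0//.
- exact: rderiv0.
- exact: rderiv_gt0.
- exact: rderiv_nd.
- exact: hU.
- exact: Nfunction_subgradient.
Qed.

Let breg_ge a b : c ^+ 3 / (136 * C) * M a b <= bregman phi a b.
Proof.
have /andP[P0 P2] := defect a b; rewrite bregmanE /M sqr_dist.
apply: breg_ge_quad => //; rewrite ?enorm_ge0//.
- exact: rderiv0.
- exact: rderiv_gt0.
- exact: Nfunction_subgradient.
Qed.

Let M_triangle a b e : M a e <= 16 / c ^+ 2 * (M a b + M b e).
Proof.
apply: quad_triangle; rewrite ?enorm_ge0 ?enorm_dist ?enorm_triangle ?enormBD//.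
- exact: rderiv0.
- exact: rderiv_gt0.
- exact: rderiv_nd.
- exact: hU.
Qed.

(** The constants of [breg_le_quad], [quad_triangle] and [breg_ge_quad]
    combined; it depends on [phi] only through [c] and [C]. *)
Definition quasi_const (c C : R) : R :=
  (c^-1 + 8) * (16 / c ^+ 2) / (c ^+ 3 / (136 * C)).

Let quasi_triangle_of_M a b e x y : M a b <= x / (c ^+ 3 / (136 * C)) ->
  M b e <= y / (c ^+ 3 / (136 * C)) ->
  bregman phi a e <= quasi_const c C * (x + y).
Proof.
have := M_triangle a b e; rewrite /quasi_const.
set k2 := 16 / c ^+ 2; set k := c ^+ 3 / (136 * C) => M2 Mx My.
have k20 : 0 <= k2 by rewrite divr_ge0// exprn_ge0// ltW.
have k10 : 0 <= c^-1 + 8 by rewrite addr_ge0// invr_ge0 ltW.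
clearbody k2 k.
apply: (le_trans (breg_le a e)); rewrite -2!mulrA ler_wpM2l//.
apply: (le_trans M2); rewrite -mulrA ler_wpM2l//.
by rewrite mulrC mulrDl lerD.
Qed.

Let M_le a b : M a b <= bregman phi a b / (c ^+ 3 / (136 * C)).
Proof. by rewrite ler_pdivlMr ?divr_gt0 ?exprn_gt0 ?mulr_gt0// mulrC breg_ge. Qed.

(** Divergences are compared with the symmetric quantity [quad], which satisfies
    a quasi-triangle inequality; for the same reason their arguments may be
    exchanged, as in the two variants that follow. *)
Lemma bregman_quasi_triangle a b e :
  bregman phi a e <= quasi_const c C * (bregman phi a b + bregman phi b e).
Proof. by apply: quasi_triangle_of_M; exact: M_le. Qed.

Lemma bregman_quasi_triangleC a b e : bregman phi b e <=
  quasi_const c C * (bregman phi a b + bregman phi a e).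
Proof.
apply: (@quasi_triangle_of_M _ a); last exact: M_le.
by rewrite MC; exact: M_le.
Qed.

Lemma bregman_quasi_triangleCC a b e : bregman phi e b <=
  quasi_const c C * (bregman phi a b + bregman phi a e).
Proof.
by rewrite addrC; exact: bregman_quasi_triangleC.
Qed.

End bregman_theory.

Lemma quasi_const_gt0 (R : realType) (c C : R) : 0 < c -> 0 < C ->
  0 < quasi_const c C.
Proof.
move=> c0 C0; have ci : 0 < c^-1 by rewrite invr_gt0.
apply: divr_gt0; last by apply: divr_gt0; rewrite ?exprn_gt0 ?mulr_gt0.
by apply: mulr_gt0; [lra|rewrite divr_gt0 ?exprn_gt0].
Qed.

(** * Borel sets and Lebesgue measure in Euclidean space *)

Section rV_topology.
Context {R : realType} {n : nat}.
Implicit Types (x y : 'rV[R]_n) (U A : set 'rV[R]_n).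

Lemma coord_le_norm x i : `|x ord0 i| <= `|x|.
Proof.
rewrite [leRHS]/Num.norm /= mx_normrE.
by apply: (@le_bigmax _ _ _ 0 (fun p : 'I_1 * 'I_n => `|x p.1 p.2|) (ord0, i)).
Qed.

Lemma norm_le_coord x e : 0 <= e -> (forall i, `|x ord0 i| <= e) -> `|x| <= e.
Proof.
move=> e0 xe; rewrite [leLHS]/Num.norm /= mx_normrE.
by apply/bigmax_leP; split=> // -[i j] _ /=; rewrite ord1.
Qed.

(** An open set is the union of the cubes that it contains among those with
    rational centre and radius 1 / (k + 1), and these are countably many. *)
Lemma open_measurable_rV U : open U -> measurable U.
Proof.
move=> oU.
pose box (p : nat * 'rV[rat]_n) : set 'rV[R]_n :=
  [set x | forall i, `|x ord0 i - ratr (p.2 ord0 i)| < p.1.+1%:R^-1].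
have mbox p : measurable (box p).
  rewrite (_ : box p = \bigcap_(i in [set: 'I_n]) ((fun x => x ord0 i) @^-1`
      [set t | `|t - ratr (p.2 ord0 i)| < p.1.+1%:R^-1])); last first.
    by apply/seteqP; split=> x /= h i; [move=> _|]; exact: h.
  apply: fin_bigcap_measurable => // i _.
  rewrite -[X in measurable X]setTI; apply: measurable_rV_coord => //.
  apply: open_measurable.
  rewrite (_ : [set _ | _] = ball (ratr (p.2 ord0 i) : R) p.1.+1%:R^-1).
    exact: ball_open.
  by apply/seteqP; split=> t; rewrite -ball_normE/= distrC.
pose F p := if `[< box p `<=` U >] then box p else set0.
rewrite (_ : U = \bigcup_p F p).
  apply: countable_bigcupT_measurable => // p; rewrite /F; case: ifP => // _.
apply/seteqP; split=> [x Ux|x [p _]]; last first.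
  by rewrite /F; case: asboolP => // /[apply].
have /nbhs_ballP[e /= e0 xeU] : nbhs x U by exact: open_nbhs_nbhs.
have [k _ /(_ k (leqnn k)) ke] :=
  near_infty_natSinv_lt (PosNum (divr_gt0 e0 (@ltr0n R 2))).
have k0 : 0 < k.+1%:R^-1 :> R by rewrite invr_gt0 ltr0n.
have qP i : exists q : rat, `|x ord0 i - ratr q| < k.+1%:R^-1.
  have : x ord0 i - k.+1%:R^-1 < x ord0 i by rewrite ltrBlDr ltrDl.
  move=> /rat_in_itvoo [q]; rewrite in_itv/= => /andP[q1 q2].
  by exists q; rewrite ger0_norm ?subr_ge0 ?(ltW q2)// ltrBlDr -ltrBlDl.
have [q qxk] := choice qP.
exists (k, \row_i q i) => //; rewrite /F.
have xbox : box (k, \row_i q i) x by move=> i /=; rewrite mxE.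
case: asboolP => // bU; exfalso; apply: bU => y ybox; apply: xeU.
rewrite -ball_normE/=; apply: le_lt_trans (_ : 2 * k.+1%:R^-1 < e); last first.
  by rewrite mulrC -ltr_pdivlMr.
apply: norm_le_coord => [|i]; first by rewrite mulr_ge0// ltW.
have := ybox i; have := xbox i; rewrite /= !mxE.
rewrite [`|y _ _ - _|]distrC => h1 h2.
rewrite (le_trans (ler_distD (ratr (q i)) _ _))// mulr_natl mulr2n.
by rewrite lerD// ltW.
Qed.

Lemma continuous_measurable_rV (f : 'rV[R]_n -> R) :
  continuous f -> measurable_fun setT f.
Proof.
move=> cf; apply: (measurability (@RGenOpens.G R)).
  exact: RGenOpens.measurableE.
move=> _ [_ [a [b ->]] <-]; rewrite setTI.
apply: open_measurable_rV; move/continuousP : cf; apply.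
exact: interval_open.
Qed.

End rV_topology.

Section bounded_measure.
Context {R : realType}.

Lemma rV_cons_head n (a : R) (x : 'rV[R]_n) : rV_cons (a, x) ord0 ord0 = a.
Proof. by case: (rV_consK (a, x)). Qed.

Lemma rV_cons_tail n (a : R) (x : 'rV[R]_n) i :
  rV_cons (a, x) ord0 (lift ord0 i) = x ord0 i.
Proof.
have [_ /rowP /(_ i)] := rV_consK (a, x); rewrite mxE => <-.
by congr (rV_cons _ _ _); exact/val_inj.
Qed.

Definition box n (k : R) : set 'rV[R]_n :=
  [set x | forall i, x ord0 i \in `[- k, k]].

Lemma measurable_box n k : measurable (@box n k).
Proof.
rewrite (_ : box k = \bigcap_(i in [set: 'I_n]) ((fun x => x ord0 i) @^-1`
    `[- k, k]%classic)).
  apply: fin_bigcap_measurable => // i _.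
  by rewrite -[X in measurable X]setTI; apply: measurable_rV_coord.
by apply/seteqP; split=> x /= h i; [move=> _|]; exact: h.
Qed.

Lemma lebesgue_box_lty n k : (lebesgue_rV R n (@box n k) < +oo)%E.
Proof.
elim: n => [|n IHn].
  by rewrite /= diracE; apply: ltry.
rewrite /= /lebesgue_rV_step /pushforward.
rewrite (_ : _ @^-1` _ = `[- k, k]%classic `*` @box n k); last first.
  apply/seteqP; split=> -[a x] /= => [h|[ak xk] i].
    split=> [|i]; first by rewrite -(rV_cons_head a x); exact: h.
    by rewrite -(rV_cons_tail a x); exact: h.
  case: (unliftP ord0 i) => [j ->|->]; last by rewrite rV_cons_head.
  by rewrite rV_cons_tail; exact: xk.
rewrite product_measure1E//; last exact: measurable_box.
apply: lte_mul_pinfty => //.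
  by rewrite /= lebesgue_measure_itv/=; case: ifP => // _; rewrite -EFinB ltry.
Qed.

Lemma lebesgue_bounded_lty n (A : set 'rV[R]_n) : measurable A ->
  bounded_set A -> (lebesgue_rV R n A < +oo)%E.
Proof.
move=> mA [M [_ HM]]; apply: le_lt_trans (lebesgue_box_lty n (M + 1)).
apply: le_measure; rewrite ?inE//; first exact: measurable_box.
move=> x Ax i; rewrite in_itv/= -ler_norml.
by apply: le_trans (coord_le_norm x i) _; apply: HM => //; rewrite ltrDl.
Qed.

End bounded_measure.

(** The inverse is cut to the positive half-line, where it is continuous. Along a
    norm this changes nothing: the remaining value 0 has inverse 0. *)
Lemma measurable_pos_inv (R : realType) :
  measurable_fun [set: measurableTypeR R]
    ((fun t : R => t^-1) \_ (`]0, +oo[%classic : set R)).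
Proof.
have minv : measurable_fun (`]0, +oo[%classic : set R) (fun t : R => t^-1).
  apply: open_continuous_measurable_fun; first exact: interval_open.
  by move=> t; rewrite inE/= in_itv/= andbT => t0; apply: inv_continuous;
    rewrite gt_eqF.
exact: (iffLR (measurable_restrictT _ (measurable_itv _)) minv).
Qed.

Section measurable_vector.
Context {d : measure_display} {T : measurableType d} {R : realType} {n : nat}.
Variable D : set T.
Hypothesis mD : measurable D.
Implicit Types f g : T -> 'rV[R]_n.

Lemma measurable_coord f i : measurable_fun D f ->
  measurable_fun D (fun x => f x ord0 i : R).
Proof. exact: measurableT_comp (measurable_rV_coord i). Qed.

Lemma measurable_dot f g : measurable_fun D f -> measurable_fun D g ->
  measurable_fun D (fun x => dot (f x) (g x)).
Proof.
move=> mf mg; apply: measurable_sum => j.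
by apply: measurable_funM; exact: measurable_coord.
Qed.

Lemma measurable_rVP f : (forall i, measurable_fun D (fun x => f x ord0 i : R)) ->
  measurable_fun D f.
Proof.
move=> mf.
apply: (@measurability _ _ _ _ _ _ (\big[setU/set0]_(i < n)
  preimage_set_system setT (@rV_coord R n i) measurable)) => //.
move=> _ [A + <-]; rewrite -bigcup_seq/= => -[i _ [B mB <-]].
by rewrite setTI; exact: (mf i mD _ mB).
Qed.

Lemma measurable_enorm f : measurable_fun D f ->
  measurable_fun D (fun x => enorm (f x)).
Proof.
move=> mf; apply: measurableT_comp (measurable_dot mf mf).
by apply: continuous_measurable_fun => x; exact: sqrt_continuous.
Qed.

(** Norms being nonnegative, [h] may be extended from the half-line to a monotone
    function on the whole line. *)
Lemma measurable_nd_enorm (h : R -> R) f :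
  (forall s t, 0 <= s -> s <= t -> h s <= h t) ->
  measurable_fun D f -> measurable_fun D (fun x => h (enorm (f x))).
Proof.
move=> hnd mf; rewrite (_ : (fun _ => _) =
    (fun t : R => h (Num.max 0 t)) \o (fun x => enorm (f x))).
  apply: measurableT_comp (measurable_enorm mf).
  apply: nondecreasing_measurable => // s t st.
  apply: hnd; first by rewrite le_max lexx.
  by rewrite ge_max !le_max lexx st orbT.
by apply/funext => x /=; rewrite max_r// enorm_ge0.
Qed.

Lemma measurable_bregman (phi : R -> R) f g :
  (forall s t, 0 <= s -> s <= t -> phi s <= phi t) ->
  (forall s t, 0 <= s -> s <= t -> rderiv phi s <= rderiv phi t) ->
  measurable_fun D f -> measurable_fun D g ->
  measurable_fun D (fun x => bregman phi (f x) (g x)).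
Proof.
move=> phi_nd dphi_nd mf mg; rewrite /bregman.
apply: measurable_funB; first by apply: measurable_funB; exact: measurable_nd_enorm.
apply: measurable_dot.
  apply: measurable_rVP => i; rewrite /flux.
  under eq_fun do rewrite mxE.
  apply: measurable_funM; last exact: measurable_coord.
  apply: measurable_funM; first exact: measurable_nd_enorm.
  rewrite (_ : (fun _ => _) =
      ((fun t : R => t^-1) \_ `]0, +oo[) \o (fun x => enorm (g x))).
    apply: measurableT_comp; last exact: measurable_enorm.
    exact: measurable_pos_inv.
  apply/funext => x /=; rewrite patchE; case: ifPn => //.
  rewrite notin_setE/= in_itv/= andbT => /negP; rewrite -leNgt => g0.
  by rewrite (_ : enorm _ = 0) ?invr0//; apply/eqP; rewrite eq_le g0 enorm_ge0.
apply: measurable_rVP => i.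
under eq_fun do rewrite !mxE.
by apply: measurable_funB; exact: measurable_coord.
Qed.

End measurable_vector.

(** * Open cells of a triangulation *)

Section barycentric.
Context {R : realType} {n m : nat}.
Variable p : 'I_m.+1 -> 'rV[R]_n.
Hypothesis p_free : row_free (edges p).

Lemma barycentric_unique (l k : 'I_m.+1 -> R) :
  \sum_j l j = \sum_j k j -> \sum_j l j *: p j = \sum_j k j *: p j -> l =1 k.
Proof.
move=> lk1 lkp.
pose dl j := l j - k j.
have d1 : \sum_j dl j = 0 by rewrite sumrB lk1 subrr.
have dp : \sum_j dl j *: p j = 0.
  by under eq_bigr do rewrite scalerBl; rewrite sumrB lkp subrr.
have d_lift : \row_j dl (lift ord0 j) = 0 :> 'rV[R]_m.
  apply: (row_free_inj p_free); rewrite mul0mx mulmx_sum_row.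
  have -> : \sum_i (\row_j dl (lift ord0 j)) ord0 i *: row i (edges p) =
      \sum_j dl j *: (p j - p ord0).
    rewrite [RHS]big_ord_recl subrr scaler0 add0r; apply: eq_bigr => i _.
    by rewrite mxE; congr (_ *: _); apply/rowP => j; rewrite !mxE.
  under eq_bigr do rewrite scalerBr.
  by rewrite sumrB dp -scaler_suml d1 scale0r subrr.
have dl0 j : dl (lift ord0 j) = 0 by have /rowP /(_ j) := d_lift; rewrite !mxE.
move=> j; apply/eqP; rewrite -subr_eq0 -/(dl j); apply/eqP.
have [i ->|->] := unliftP ord0 j; first exact: dl0.
move: d1; rewrite big_ord_recl big1 ?addr0// => i _; exact: dl0.
Qed.

(** Moving an interior point of the face slightly towards the vertex [a] would
    give it a positive barycentric coordinate there. *)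
Lemma proper_face_no_interior (J : 'I_m.+1 -> Prop) a :
  ~ J a -> (face p J)° = set0.
Proof.
move=> Ja; rewrite -subset0 => x /= xJ.
have [l [l0 lJ l1 lx]] := interior_subset xJ.
have /nbhs_ballP[e /= e0 xe] := xJ.
pose d := p a - x.
pose t := e / (`|d| + 1).
have d1 : 0 < `|d| + 1 by rewrite ltr_wpDl.
have t0 : 0 < t by rewrite divr_gt0.
have [k [k0 kJ k1 kx]] : face p J (x + t *: d).
  apply: xe; rewrite -ball_normE/= opprD addNKr normrN normrZ gtr0_norm//.
  by rewrite /t mulrAC ltr_pdivrMr// ltr_pM2l// ltrDl.
pose k' j := (1 - t) * l j + t * (j == a)%:R.
have delta_sum (V : lmodType R) (q : 'I_m.+1 -> V) :
    \sum_j (t * (j == a)%:R) *: q j = t *: q a.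
  rewrite (bigD1 a)//= eqxx mulr1 big1 ?addr0// => j /negbTE ->.
  by rewrite mulr0 scale0r.
have k'k : k' =1 k.
  apply: barycentric_unique.
    rewrite k1 /k' big_split/= -mulr_sumr l1 mulr1.
    have := delta_sum R^o (fun=> 1); rewrite /GRing.scale/=.
    by under eq_bigr do rewrite mulr1; rewrite mulr1 => ->; rewrite subrK.
  rewrite -kx /k'; under eq_bigr do rewrite scalerDl.
  rewrite big_split/= delta_sum; under eq_bigr do rewrite -scalerA.
  by rewrite -scaler_sumr -lx /d scalerBr scalerBl scale1r addrAC addrA.
have := k'k a; rewrite kJ// /k' lJ// eqxx mulr0 add0r mulr1 => t00.
by move: t0; rewrite t00 ltxx.
Qed.

End barycentric.

Section cells.
Context {R : realType} {n : nat}.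
Variables (M : mesh R n) (Omega : set 'rV[R]_n.+1).
Hypothesis hT : triangulation M Omega.

(** The intersection of two simplices is a common face. If it is proper for one
    of them it has no interior; otherwise each of them contains the other. *)
Lemma cell_disjoint (i j : elt M) : i != j -> cell i `&` cell j = set0.
Proof.
have [free _ inj meet] := hT.
move=> ij; rewrite /cell -interiorI -subset0 => x xij.
pose J (i' j' : elt M) a := exists b, vert i' a = vert j' b.
have full (i' j' : elt M) : (simplex (vert i') `&` simplex (vert j'))° x ->
    simplex (vert i') `<=` simplex (vert j').
  rewrite meet -/(J i' j') => xJ.
  have [h|/existsNP[a Ja]] := pselect (forall a, J i' j' a).
    rewrite -[X in X `<=` _](_ : simplex (vert i') `&` simplex (vert j') = _).
      exact: subIsetr.
    rewrite meet; apply/seteqP; split=> y [l [l0 lJ l1 ly]]; exists l; split=> //.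
    by move=> a /(_ (h a)).
  by move: xJ; rewrite (proper_face_no_interior (free i') Ja).
move: ij; apply/negP; rewrite negbK; apply/eqP/inj/seteqP; split; apply: full => //.
by rewrite setIC.
Qed.

Lemma open_cell (i : elt M) : open (cell i).
Proof. exact: open_interior. Qed.

Lemma measurable_cell (i : elt M) : measurable (cell i).
Proof. by apply: open_measurable_rV; exact: open_cell. Qed.

Lemma cell_uniq (i j : elt M) x : cell i x -> cell j x -> i = j.
Proof.
move=> ix jx; apply/eqP; rewrite -[_ == _]negbK; apply/negP => /cell_disjoint ij.
by have : (cell i `&` cell j) x by []; rewrite ij.
Qed.

Lemma cell_sub_closure (i : elt M) : cell i `<=` (closure Omega)°.
Proof.
have [_ cov _ _] := hT; apply: interiorS; rewrite cov => x ix.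
by exists i.
Qed.

End cells.

Section lipschitz.
Context {R : realType} {n : nat}.
Variable Omega : set 'rV[R]_n.+1.

Lemma enorm_le_norm k (x : 'rV[R]_k) : enorm x <= k.+1%:R * `|x|.
Proof.
rewrite -(@ler_pXn2r _ 2) ?nnegrE ?enorm_ge0 ?mulr_ge0// enorm_sqr.
apply: (@le_trans _ _ (\sum_(j < k) `|x| ^+ 2)).
  apply: ler_sum => j _; rewrite -expr2 -real_normK ?num_real//.
  by rewrite ler_pXn2r ?nnegrE// coord_le_norm.
rewrite sumr_const card_ord exprMn -[leLHS]mulr_natl ler_wpM2r ?sqr_ge0//.
by rewrite -natrX ler_nat (leq_trans (leqnSn _))// -{1}(expn1 k.+1) leq_pexp2l.
Qed.

Lemma coord_le_enorm k (x : 'rV[R]_k) i : `|x ord0 i| <= enorm x.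
Proof.
rewrite -(@ler_pXn2r _ 2) ?nnegrE ?enorm_ge0// enorm_sqr real_normK ?num_real//.
rewrite /dot (bigD1 i)//= -expr2 lerDl; apply: sumr_ge0 => j _.
by rewrite -expr2 sqr_ge0.
Qed.

Lemma nbhs_enorm (x : 'rV[R]_n.+1) e : 0 < e ->
  nbhs x [set y | enorm (y - x) < e].
Proof.
move=> e0; apply/nbhs_ballP; exists (e / n.+2%:R); first by rewrite /= divr_gt0.
move=> y; rewrite -ball_normE/= distrC ltr_pdivlMr// mulrC.
exact: le_lt_trans (enorm_le_norm _).
Qed.

Lemma enorm_orthogonal (Q : 'M[R]_n.+1) (x : 'rV[R]_n.+1) : Q *m Q^T = 1%:M ->
  enorm (x *m Q) = enorm x.
Proof.
move=> QQ; have dotE (a : 'rV[R]_n.+1) : dot a a = (a *m a^T) ord0 ord0.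
  by rewrite mxE; apply: eq_bigr => j _; rewrite mxE.
by rewrite /enorm !dotE trmx_mul mulmxA -(mulmxA x) QQ mulmx1.
Qed.

Lemma enorm_lift (x : 'rV[R]_n.+1) :
  enorm (\row_j x ord0 (lift ord0 j)) <= enorm x.
Proof.
rewrite -(@ler_pXn2r _ 2) ?nnegrE ?enorm_ge0// !enorm_sqr.
rewrite [leRHS]/dot big_ord_recl -expr2 ler_wpDl ?sqr_ge0//.
by apply: ler_sum => j _; rewrite !mxE.
Qed.

(** Points below the graph of the chart, at depth [t] under a boundary point,
    keep a distance proportional to [t] from the domain; hence no neighbourhood
    of a boundary point lies in the closure. It follows that the cells of a
    triangulation, being open subsets of the closure, lie in the domain. *)
Lemma interior_closure_lipschitz : open Omega -> lipschitz_boundary Omega ->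
  (closure Omega)° `<=` Omega.
Proof.
move=> oO lip x xO; apply: contrapT => nOx.
have xbd : bdry Omega x.
  by split; [exact: interior_subset|move=> /interior_subset].
have [r [L [Q [gamma [r0 QQ gammaL chart]]]]] := lip _ xbd.
have QtQ : Q^T *m Q = 1%:M := mulmx1C QQ.
have [e /= e0 xe] : nbhs_ball x (closure Omega) by apply/nbhs_ballP.
have gamma0 : 0 <= gamma 0.
  rewrite leNgt; apply/negP => g0; apply: nOx; apply/chart.
    by rewrite subrr enorm0.
  rewrite subrr mul0mx mxE.
  by rewrite (_ : \row_j _ = 0)//; apply/rowP => j; rewrite !mxE.
pose v : 'rV[R]_n.+1 := - delta_mx ord0 ord0.
pose w := v *m Q^T.
have w0 : 0 < `|w| + enorm w + 1 by rewrite ltr_wpDl// addr_ge0// enorm_ge0.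
(* [x + t *: w] has depth [t], lies within [e] of [x], and its [rho]-ball lies
   within the radius [r] of the chart. There the graph drops by at most
   [`|L| * rho], so that the ball, of height at most [rho - t], stays below. *)
pose t := Num.min e r / (`|w| + enorm w + 1).
have t0 : 0 < t by rewrite divr_gt0// lt_min e0.
have tE : t * `|w| + t * enorm w + t = Num.min e r.
  transitivity (t * (`|w| + enorm w + 1)); first by ring.
  by rewrite /t divfK// gt_eqF.
have min_e : Num.min e r <= e by rewrite ge_min lexx.
have min_r : Num.min e r <= r by rewrite ge_min lexx orbT.
have tw : 0 <= t * `|w| by rewrite mulr_ge0// ltW.
have tew : 0 <= t * enorm w by rewrite mulr_ge0 ?enorm_ge0// ltW.
have L1 : 1 <= `|L| + 1 by rewrite lerDr.
pose rho := t / (2 * (`|L| + 1)).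
have rho0 : 0 < rho by rewrite divr_gt0// mulr_gt0//; lra.
have rhoE : 2 * (`|L| * rho) + 2 * rho = t.
  transitivity (rho * (2 * (`|L| + 1))); first by ring.
  by rewrite /rho divfK// gt_eqF// mulr_gt0//; lra.
have Lrho : 0 <= `|L| * rho by rewrite mulr_ge0// ltW.
have : closure Omega (x + t *: w).
  apply: xe; rewrite -ball_normE/= opprD addNKr normrN normrZ gtr0_norm//; lra.
move=> /(_ _ (nbhs_enorm (x + t *: w) rho0)) [y [/= Oy yxw]].
pose zeta := (y - (x + t *: w)) *m Q.
have nzeta : enorm zeta < rho by rewrite enorm_orthogonal.
have zE : (y - x) *m Q = t *: v + zeta.
  have -> : y - x = t *: w + (y - (x + t *: w)).
    by rewrite [RHS]addrC opprD addrA subrK.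
  by rewrite mulmxDl -scalemxAl /w -mulmxA QtQ mulmx1.
clearbody zeta.
have yr : enorm (y - x) < r.
  have -> : y - x = (y - (x + t *: w)) + t *: w by rewrite opprD addrA subrK.
  rewrite (le_lt_trans (enormD _ _))// enormZ gtr0_norm//; lra.
have /(chart _ yr) := Oy.
rewrite zE (_ : \row_j _ = \row_j zeta ord0 (lift ord0 j)); last first.
  by apply/rowP => j; rewrite !mxE/= oppr0 mulr0 add0r.
rewrite !mxE eqxx/= => lt_z.
have /ler_normlP[_ z0] := le_trans (coord_le_enorm zeta ord0) (ltW nzeta).
have := gammaL 0 (\row_j zeta ord0 (lift ord0 j)).
rewrite sub0r enormN => /ler_normlP[_ gz].
have : L * enorm (\row_j zeta ord0 (lift ord0 j)) <= `|L| * rho.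
  rewrite (le_trans (ler_wpM2r (enorm_ge0 _) (ler_norm L)))// ler_wpM2l//.
  by rewrite (le_trans (enorm_lift _))// ltW.
lra.
Qed.

End lipschitz.

(** * Integrals of elementwise given functions *)

Section bounded_measurable.
Context {d : measure_display} {T : measurableType d} {R : realType}.
Implicit Types (D A : set T) (f g : T -> R).

(** A class stable under all operations that occur on elementwise polynomial
    functions, and contained in the integrable functions on sets of finite
    measure. *)
Definition bounded_measurable D f : Prop :=
  measurable_fun D f /\ exists B, forall x, D x -> `|f x| <= B.

Lemma bmeas_cst D k : bounded_measurable D (cst k).
Proof. by split=> //; exists `|k|. Qed.

Lemma bmeasD D f g : bounded_measurable D f -> bounded_measurable D g ->
  bounded_measurable D (fun x => f x + g x).
Proof.
move=> [mf [B fB]] [mg [C gC]]; split; first exact: measurable_funD.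
by exists (B + C) => x Dx; rewrite (le_trans (ler_normD _ _))// lerD ?fB ?gC.
Qed.

Lemma bmeasM D f g : bounded_measurable D f -> bounded_measurable D g ->
  bounded_measurable D (fun x => f x * g x).
Proof.
move=> [mf [B fB]] [mg [C gC]]; split; first exact: measurable_funM.
by exists (B * C) => x Dx; rewrite normrM ler_pM ?fB ?gC.
Qed.

Lemma bmeasB D f g : bounded_measurable D f -> bounded_measurable D g ->
  bounded_measurable D (fun x => f x - g x).
Proof.
move=> [mf [B fB]] [mg [C gC]]; split; first exact: measurable_funB.
by exists (B + C) => x Dx; rewrite (le_trans (ler_normB _ _))// lerD ?fB ?gC.
Qed.

Lemma bmeas_sum (I : Type) (s : seq I) D (f : I -> T -> R) :
  (forall i, bounded_measurable D (f i)) ->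
  bounded_measurable D (fun x => \sum_(i <- s) f i x).
Proof.
move=> bf; elim: s => [|i s IHs].
  by under eq_fun do rewrite big_nil; exact: bmeas_cst.
by under eq_fun do rewrite big_cons; exact: bmeasD.
Qed.

Lemma bmeas_restrict D A f : measurable D -> measurable A -> A `<=` D ->
  bounded_measurable A f -> bounded_measurable D (f \_ A).
Proof.
move=> mD mA AD [mf [B fB]]; split.
  by apply/(measurable_restrict _ mA mD); rewrite setIidr.
exists (Num.max B 0) => x _; rewrite patchE; case: ifPn => [|_].
  by rewrite inE => /fB; rewrite le_max => ->.
by rewrite normr0 le_max lexx orbT.
Qed.

Lemma bmeasS D A f : measurable D -> A `<=` D ->
  bounded_measurable D f -> bounded_measurable A f.
Proof.
move=> mD AD [mf [B fB]]; split; first exact: measurable_funS mf.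
by exists B => x /AD /fB.
Qed.

Variable mu : {measure set T -> \bar R}.

Lemma bmeas_integrable D f : measurable D -> (mu D < +oo)%E ->
  bounded_measurable D f -> mu.-integrable D (EFin \o f).
Proof.
move=> mD Doo [mf [B fB]]; apply: measurable_bounded_integrable => //.
exists B; split; first exact: num_real.
by move=> k Bk x Dx; exact: le_trans (fB x Dx) (ltW Bk).
Qed.

Lemma Rintegral_sum (I : Type) (s : seq I) D (f : I -> T -> R) :
  measurable D -> (mu D < +oo)%E -> (forall i, bounded_measurable D (f i)) ->
  \int[mu]_(x in D) (\sum_(i <- s) f i x) = \sum_(i <- s) \int[mu]_(x in D) f i x.
Proof.
move=> mD Doo bf; elim: s => [|i s IHs].
  rewrite big_nil; under eq_Rintegral do rewrite big_nil.
  by rewrite Rintegral_cst// mul0r.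
rewrite big_cons; under eq_Rintegral do rewrite big_cons.
rewrite RintegralD// ?IHs//; apply: bmeas_integrable => //.
exact: bmeas_sum.
Qed.

End bounded_measurable.

Section piecewise_functions.
Context {R : realType} {n : nat}.
Local Notation rV := 'rV[R]_n.+1.
Local Notation leb := (lebesgue_rV R n.+1).
Variables (M : mesh R n) (Omega : set rV).
Hypothesis hT : triangulation M Omega.
Hypothesis hO : bounded_lipschitz_domain Omega.

Let mOmega : measurable Omega.
Proof. by have [_ oO _ _ _] := hO; exact: open_measurable_rV. Qed.

Lemma cell_sub (i : elt M) : cell i `<=` Omega.
Proof.
have [_ oO _ _ lip] := hO.
by move=> x /(cell_sub_closure hT); exact: interior_closure_lipschitz.
Qed.

Let Omega_lty : (leb Omega < +oo)%E.
Proof. by have [_ _ _ bO _] := hO; exact: lebesgue_bounded_lty. Qed.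

Lemma cell_lty (i : elt M) : (leb (cell i) < +oo)%E.
Proof.
apply: le_lt_trans Omega_lty; apply: le_measure; rewrite ?inE//.
  exact: measurable_cell.
exact: cell_sub.
Qed.

Lemma piecewise_in (V : zmodType) (h : elt M -> rV -> V) i x :
  cell i x -> piecewise h x = h i x.
Proof.
move=> ix; rewrite /piecewise (big_pred1 i)// => j.
apply/idP/eqP => [/set_mem jx|->]; last exact/mem_set.
exact: cell_uniq hT _ _ _ jx ix.
Qed.

Lemma piecewise_out (V : zmodType) (h : elt M -> rV -> V) x :
  (forall i : elt M, ~ cell i x) -> piecewise h x = 0.
Proof. by move=> nx; rewrite /piecewise big1// => i /set_mem /nx. Qed.

Lemma piecewise_case x : (exists i : elt M, cell i x) \/
  (forall i : elt M, ~ cell i x).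
Proof.
by have [|/forallNP] := pselect (exists i : elt M, cell i x); [left|right].
Qed.

Lemma piecewiseE (h : elt M -> rV -> R) :
  piecewise h = fun x => \sum_i (h i \_ (cell i)) x.
Proof.
by apply/funext => x; rewrite /piecewise big_mkcond;
  under [RHS]eq_bigr do rewrite patchE.
Qed.

Lemma bmeas_piecewise (h : elt M -> rV -> R) :
  (forall i, bounded_measurable (cell i) (h i)) ->
  bounded_measurable Omega (piecewise h).
Proof.
move=> bh; rewrite piecewiseE; apply: bmeas_sum => i.
by apply: bmeas_restrict => //; [exact: measurable_cell|exact: cell_sub].
Qed.

Lemma Rintegral_piecewise (h : elt M -> rV -> R) :
  (forall i, bounded_measurable (cell i) (h i)) ->
  \int[leb]_(x in Omega) piecewise h x = \sum_i \int[leb]_(x in cell i) h i x.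
Proof.
move=> bh; rewrite piecewiseE Rintegral_sum//.
  apply: eq_bigr => i _; rewrite -Rintegral_mkcondr setIidr//; exact: cell_sub.
move=> i; apply: bmeas_restrict => //; [exact: measurable_cell|exact: cell_sub].
Qed.

Lemma piecewise_dot (h k : elt M -> rV -> rV) x :
  dot (piecewise h x) (piecewise k x) =
  piecewise (fun i x => dot (h i x) (k i x)) x.
Proof.
have [[i ix]|nx] := piecewise_case x; first by rewrite !(piecewise_in _ ix).
by rewrite !piecewise_out// dot0l.
Qed.

Lemma piecewiseB (V : zmodType) (h k : elt M -> rV -> V) x :
  piecewise h x - piecewise k x = piecewise (fun i x => h i x - k i x) x.
Proof. by rewrite /piecewise -sumrB. Qed.

Lemma piecewise_coord (h : elt M -> rV -> rV) j x :
  piecewise h x ord0 j = piecewise (fun i x => h i x ord0 j) x.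
Proof. by rewrite /piecewise summxE. Qed.

Lemma bmeas_coord j : bounded_measurable Omega (fun x : rV => x ord0 j).
Proof.
split; first exact: measurable_funTS (measurable_rV_coord j).
have [_ _ _ [B [_ OB]] _] := hO; exists (B + 1) => x Ox.
by apply: le_trans (coord_le_norm x j) _; apply: OB => //; rewrite ltrDl.
Qed.

Lemma bmeas_rt_at (s : rt M) i j :
  bounded_measurable Omega (fun x => rt_at s i x ord0 j).
Proof.
rewrite /rt_at; under eq_fun do rewrite !mxE.
apply: bmeasD; first exact: bmeas_cst.
apply: bmeasM; first exact: bmeas_cst.
apply: bmeasD; [exact: bmeas_coord|exact: bmeas_cst].
Qed.

Lemma bmeas_dot (D : set rV) (f g : rV -> rV) :
  (forall j, bounded_measurable D (fun x => f x ord0 j)) ->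
  (forall j, bounded_measurable D (fun x => g x ord0 j)) ->
  bounded_measurable D (fun x => dot (f x) (g x)).
Proof. by move=> bf bg; apply: bmeas_sum => j; exact: bmeasM. Qed.

Lemma bmeas_rt_cell (s : rt M) i j :
  bounded_measurable (cell i) (fun x => rt_at s i x ord0 j).
Proof.
apply: (@bmeasS _ _ _ Omega) => //; first exact: cell_sub.
exact: bmeas_rt_at.
Qed.

Lemma bmeas_rt_fun (s : rt M) j :
  bounded_measurable Omega (fun x => rt_fun s x ord0 j).
Proof.
rewrite /rt_fun; under eq_fun do rewrite piecewise_coord.
by apply: bmeas_piecewise => i; exact: bmeas_rt_cell.
Qed.

Lemma bmeas_continuous (f : rV -> R) : continuous f -> bounded_measurable Omega f.
Proof.
move=> cf; split; first by apply: measurable_funTS; exact: continuous_measurable_rV.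
have [_ _ _ [B [_ OB]] _] := hO.
have cK : compact (@box R n.+1 (B + 1)).
  apply: (@rV_compact R n.+1 (fun=> `[- (B + 1), B + 1]%classic)) => i.
  exact: segment_compact.
have : compact (f @` box (B + 1)).
  by apply: continuous_compact => //; exact: continuous_subspaceT.
move=> /compact_bounded[C [_ fC]]; exists (C + 1) => x Ox.
apply: fC; first by rewrite ltrDl.
exists x => // i; rewrite in_itv/= -ler_norml.
by apply: le_trans (coord_le_norm x i) _; apply: OB => //; rewrite ltrDl.
Qed.

(** Both weak divergences are integrals of bounded measurable functions, hence
    linear: the gradient of a test function is continuous, thus bounded on the
    bounded domain. *)
Lemma weak_divB (s s' : rt M) w :
  weak_div Omega (rt_fun s) w -> weak_div Omega (rt_fun s') w ->
  weak_div Omega (rt_fun (fun i => s i - s' i)) (fun=> 0).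
Proof.
move=> ws ws' eta test.
have [smooth_eta _ _] := test.
have bgrad j : bounded_measurable Omega (fun x => grad eta x ord0 j).
  under eq_fun do rewrite mxE.
  apply: bmeas_continuous.
  by have [_ /(_ j) [_ []]] := smooth_eta 1%N.
have bdot (t : rt M) :
    bounded_measurable Omega (fun x => dot (rt_fun t x) (grad eta x)).
  by apply: bmeas_dot => // j; exact: bmeas_rt_fun.
transitivity (\int[leb]_(x in Omega)
    (dot (rt_fun s x) (grad eta x) - dot (rt_fun s' x) (grad eta x))).
  apply: eq_Rintegral => x _; rewrite -dotBl /rt_fun piecewiseB.
  congr dot; apply: eq_bigr => i _.
  by rewrite /rt_at/= scalerBl opprD addrACA.
rewrite RintegralB//; try by apply: bmeas_integrable.
rewrite ws// ws'// subrr.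
under [in RHS]eq_Rintegral do rewrite mul0r.
by rewrite Rintegral_cst// mul0r oppr0.
Qed.

End piecewise_functions.

(** * Comparison of integrals *)

Section integral_lemmas.
Context {d : measure_display} {T : measurableType d} {R : realType}.
Variables (mu : {measure set T -> \bar R}) (D : set T).
Hypothesis mD : measurable D.

Lemma EFin_Rintegral (f : T -> R) : mu.-integrable D (EFin \o f) ->
  (\int[mu]_(x in D) f x)%:E = (\int[mu]_(x in D) (f x)%:E)%E.
Proof. by move=> intf; rewrite /Rintegral fineK//; exact: integrable_fin_num. Qed.

(** Adding the negative part of the perturbation on one side and its positive
    part on the other keeps all integrands nonnegative, so that only these two
    parts have to be integrable. *)
Lemma ge0_integral_perturb (G H h : T -> R) : (mu D < +oo)%E ->
  measurable_fun D G -> measurable_fun D H -> bounded_measurable D h ->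
  (forall x, D x -> 0 <= G x) -> (forall x, D x -> 0 <= H x) ->
  \int[mu]_(x in D) h x = 0 ->
  {ae mu, forall x, D x -> G x = H x + h x} ->
  (\int[mu]_(x in D) (G x)%:E = \int[mu]_(x in D) (H x)%:E)%E.
Proof.
move=> Doo mG mH [mh [B hB]] G0 H0 h0 GHh.
pose hp x := Num.max (h x) 0; pose hm x := Num.max (- h x) 0.
have hpm x : hp x - hm x = h x.
  by rewrite /hp /hm; case: (leP (h x) 0); case: (leP (- h x) 0); lra.
have hp0 x : 0 <= hp x by rewrite /hp le_max lexx orbT.
have hm0 x : 0 <= hm x by rewrite /hm le_max lexx orbT.
have bhp : bounded_measurable D hp.
  split; first exact: measurable_maxr.
  exists B => x /hB; rewrite ler_norml => /andP[h1 h2].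
  by rewrite ger0_norm// ge_max; apply/andP; split; lra.
have bhm : bounded_measurable D hm.
  split; first by apply: measurable_maxr => //; exact: measurableT_comp.
  exists B => x /hB; rewrite ler_norml => /andP[h1 h2].
  by rewrite ger0_norm// ge_max; apply/andP; split; lra.
have ihp := bmeas_integrable mD Doo bhp; have ihm := bmeas_integrable mD Doo bhm.
have hphm : (\int[mu]_(x in D) (hp x)%:E = \int[mu]_(x in D) (hm x)%:E)%E.
  rewrite -!EFin_Rintegral//; congr EFin; apply/eqP.
  rewrite -subr_eq0 -RintegralB// -[X in _ == X]h0; apply/eqP.
  by apply: eq_Rintegral => x _; rewrite hpm.
have mE (f : T -> R) : measurable_fun D f -> measurable_fun D (EFin \o f).
  by move=> mf; exact/measurable_EFinP.
have : (\int[mu]_(x in D) ((G x)%:E + (hm x)%:E) =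
        \int[mu]_(x in D) ((H x)%:E + (hp x)%:E))%E.
  apply: ge0_ae_eq_integral => //.
  - by apply: emeasurable_funD; apply: mE => //; case: bhm.
  - by apply: emeasurable_funD; apply: mE => //; case: bhp.
  - by move=> x Dx; rewrite adde_ge0// lee_fin ?G0.
  - by move=> x Dx; rewrite adde_ge0// lee_fin ?H0.
  apply: filterS GHh => x /[apply] GE.
  by rewrite GE -!EFinD; congr EFin; rewrite -(hpm x); ring.
rewrite !ge0_integralD//; try by [move=> x Dx; rewrite lee_fin ?G0 ?H0|
  apply: mE; case: bhm|apply: mE; case: bhp|exact: mE].
rewrite hphm => /(congr1 (fun z => z - \int[mu]_(x in D) (hm x)%:E))%E.
by rewrite !addeK//; exact: integrable_fin_num.
Qed.

Lemma integral_le_comb (f g1 g2 : T -> R) k : 0 <= k ->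
  measurable_fun D f -> measurable_fun D g1 -> measurable_fun D g2 ->
  (forall x, D x -> 0 <= f x) -> (forall x, D x -> 0 <= g1 x) ->
  (forall x, D x -> 0 <= g2 x) ->
  {ae mu, forall x, D x -> f x <= k * (g1 x + g2 x)} ->
  (\int[mu]_(x in D) (f x)%:E <=
   k%:E * (\int[mu]_(x in D) (g1 x)%:E + \int[mu]_(x in D) (g2 x)%:E))%E.
Proof.
move=> k0 mf mg1 mg2 f0 g10 g20 fg.
have mE (h : T -> R) : measurable_fun D h -> measurable_fun D (EFin \o h).
  by move=> mh; exact/measurable_EFinP.
rewrite -ge0_integralD//; [|exact: mE..].
rewrite -ge0_integralZl_EFin//; last 2 first.
- by move=> x Dx; rewrite adde_ge0// lee_fin ?g10 ?g20.
- by apply: emeasurable_funD; exact: mE.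
apply: ae_ge0_le_integral => //.
- exact: mE.
- by move=> x Dx; rewrite mule_ge0 ?adde_ge0// lee_fin ?g10 ?g20.
- by apply: measurable_funeM; apply: emeasurable_funD; exact: mE.
Qed.

End integral_lemmas.

(** For finite infima, nearly optimal [s] and [t] are chosen independently of
    each other. *)
Lemma le_mule_ereal_infD (R : realType) (S T : set \bar R) (k : R) x :
  0 < k -> (forall s, S s -> 0 <= s)%E -> (forall t, T t -> 0 <= t)%E ->
  (forall s t, S s -> T t -> x <= k%:E * (s + t))%E ->
  (x <= k%:E * (ereal_inf S + ereal_inf T))%E.
Proof.
move=> k0 S0 T0 xst; rewrite muleC -lee_pdivrMr//.
have iS0 : (0 <= ereal_inf S)%E by apply: le_ereal_inf_tmp => s /S0.
have iT0 : (0 <= ereal_inf T)%E by apply: le_ereal_inf_tmp => s /T0.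
have [->|Soo] := eqVneq (ereal_inf S) +oo%E.
  by rewrite addye ?leey// gt_eqF// (lt_le_trans _ iT0).
have [->|Too] := eqVneq (ereal_inf T) +oo%E.
  by rewrite addey ?leey// gt_eqF// (lt_le_trans _ iS0).
have finS : ereal_inf S \is a fin_num by rewrite ge0_fin_numE// ltey.
have finT : ereal_inf T \is a fin_num by rewrite ge0_fin_numE// ltey.
apply/lee_addgt0Pr => e e0.
have e20 : 0 < e / 2 by rewrite divr_gt0.
have [s Ss /ltW se] := lb_ereal_inf_adherent e20 finS.
have [t Tt /ltW te] := lb_ereal_inf_adherent e20 finT.
rewrite lee_pdivrMr// muleC; apply: (le_trans (xst _ _ Ss Tt)).
rewrite lee_wpmul2l ?lee_fin ?(ltW k0)//; apply: (le_trans (leeD se te)).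
by rewrite addeACA -EFinD -splitr.
Qed.

(** * Discrete orthogonality *)

Section orthogonality.
Context {R : realType} {n : nat}.
Local Notation rV := 'rV[R]_n.+1.
Local Notation leb := (lebesgue_rV R n.+1).
Variables (M : mesh R n) (Omega GD GN : set rV).
Hypothesis hT : triangulation M Omega.
Hypothesis hO : bounded_lipschitz_domain Omega.
Variables (f : rV -> R) (F : rV -> rV) (g : rV -> R).

Lemma VhD_sub (v u : p1 M) : VhD GD v -> VhD GD u ->
  VhD GD (fun i => v i - u i : R * rV).
Proof.
have atB i x : p1_at (fun i => v i - u i : R * rV) i x = p1_at v i x - p1_at u i x.
  by rewrite /p1_at/= dotBl; ring.
move=> [vV vD] [uV uD]; split=> [i k j kj|i k ik]; rewrite !atB.
  by rewrite (vV _ _ _ kj) (uV _ _ _ kj).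
by rewrite vD// uD// subrr.
Qed.

(** The factor in front cancels the normalisation of the mean, and both sides
    vanish on a null cell. The mean enters only through this integral, not as
    the value at the barycenter. *)
Lemma measure_mean_sub (r q : rV -> rV) (s s' : rt M) i j :
  r = (fun x => Pihv M F x + rt_fun s x) ->
  q = (fun x => Pihv M F x + rt_fun s' x) ->
  fine (leb (cell i)) *
    (mean (fun x => r x ord0 j) i - mean (fun x => q x ord0 j) i) =
  \int[leb]_(x in cell i) rt_at (fun i => s i - s' i : rV * R) i x ord0 j.
Proof.
move=> rE qE; have mc := measurable_cell i.
have coo := cell_lty hT hO i.
have bt (t : rt M) := bmeas_rt_cell hT hO t i j.
have intt (t : rt M) := bmeas_integrable mc coo (bt t).
have [c0|c0] := eqVneq (fine (leb (cell i))) 0.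
  rewrite c0 mul0r /Rintegral null_set_integral//.
    exact: (measurable_int leb (intt _)).
  by apply/eqP; rewrite -fine_eq0 ?c0 ?eqxx// ge0_fin_numE.
rewrite /mean -mulrBr mulrA divff// mul1r.
have bc k : bounded_measurable (cell i) (cst k : rV -> R) := bmeas_cst _ k.
have E (t : rt M) : \int[leb]_(x in cell i) (Pihv M F x + rt_fun t x) ord0 j =
    \int[leb]_(x in cell i) (mean (fun x => F x ord0 j) i + rt_at t i x ord0 j).
  apply: eq_Rintegral => x /set_mem ix.
  by rewrite /Pihv /rt_fun !(piecewise_in hT _ ix) !mxE.
rewrite rE qE !E -RintegralB//;
  try (by apply: bmeas_integrable => //; exact: bmeasD (bc _) (bt _)).
apply: eq_Rintegral => x _; rewrite /rt_at !mxE/=.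
by ring.
Qed.

(** Gradients are constant on each cell, so under the integral the mean of a
    difference of fluxes can be traded for the difference [sd] itself; the latter
    is a divergence-free Raviart-Thomas field with vanishing normal trace on the
    Neumann boundary, orthogonal to discrete gradients by discrete integration
    by parts. *)
Lemma discrete_orthogonality (v u : p1 M) (r q : rV -> rV) :
  discrete_integration_by_parts M Omega GD GN ->
  VhD GD v -> VhD GD u -> Kh M Omega GN f F g r -> Kh M Omega GN f F g q ->
  \int[leb]_(x in Omega)
    dot (Pihv M r x - Pihv M q x) (p1_grad v x - p1_grad u x) = 0.
Proof.
move=> ibp vD uD [s [_ rE ws ns]] [s' [_ qE ws' ns']].
pose w : p1 M := fun i => v i - u i.
pose sd : rt M := fun i => s i - s' i.
have bsd i : bounded_measurable (cell i) (fun x => dot (rt_at sd i x) (w i).2).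
  by apply: bmeas_dot => j; [exact: (bmeas_rt_cell hT hO)|exact: bmeas_cst].
have nsd : normal_trace_eq Omega GN sd (fun=> 0).
  move=> i k nu x b o fx Gx; have := ns _ _ _ _ b o fx Gx.
  rewrite -(ns' _ _ _ _ b o fx Gx) => /eqP; rewrite -subr_eq0 -dotBl => /eqP <-.
  by congr dot; rewrite /rt_at/= scalerBl opprD addrACA.
have := ibp w sd (fun=> 0) (VhD_sub vD uD) (integrable0 _ _)
  (weak_divB hT hO ws ws') nsd.
have -> : \int[leb]_(x in Omega)
    (p1_fun w x * 0 + dot (rt_fun sd x) (p1_grad w x)) =
  \int[leb]_(x in Omega) piecewise (fun i x => dot (rt_at sd i x) (w i).2) x.
  by apply: eq_Rintegral => x _; rewrite mulr0 add0r (piecewise_dot hT).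
rewrite (Rintegral_piecewise hT hO bsd) => <-.
pose m (i : elt M) := (\row_j mean (fun x => r x ord0 j) i -
             \row_j mean (fun x => q x ord0 j) i) : rV.
transitivity (\int[leb]_(x in Omega)
    piecewise (fun i (x : rV) => dot (m i) (w i).2) x).
  by apply: eq_Rintegral => x _; rewrite !piecewiseB (piecewise_dot hT).
rewrite (Rintegral_piecewise hT hO); last by move=> i; exact: bmeas_cst.
apply: eq_bigr => i _; rewrite Rintegral_cst; last exact: measurable_cell.
have mc := measurable_cell i; have coo := cell_lty hT hO i.
rewrite /dot Rintegral_sum//; last first.
  by move=> j; apply: bmeasM; [exact: (bmeas_rt_cell hT hO)|exact: bmeas_cst].
rewrite mulr_suml; apply: eq_bigr => j _.
rewrite RintegralZr//; last first.
  by apply: bmeas_integrable => //; exact: (bmeas_rt_cell hT hO).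
rewrite -(measure_mean_sub _ _ rE qE) /m !mxE.
by ring.
Qed.

End orthogonality.

(** * The error identity and its consequence *)

Section error_identity.
Context {R : realType} {n : nat}.
Local Notation rV := 'rV[R]_n.+1.
Local Notation leb := (lebesgue_rV R n.+1).
Variables (cuc Cuc : R) (phi : R -> R) (M : mesh R n) (Omega GD GN : set rV).
Variables (f : rV -> R) (F : rV -> rV) (g : rV -> R).
Variables (uh : p1 M) (qh : rV -> rV).
Hypotheses (cuc0 : 0 < cuc) (Cuc0 : 0 < Cuc).
Hypotheses (hN : is_Nfunction phi) (hU : uniformly_convex cuc Cuc phi).
Hypotheses (hT : triangulation M Omega) (hO : bounded_lipschitz_domain Omega).
Hypotheses (hD : discrete_solution Omega GD GN phi f F g uh qh).
Hypothesis hflux : discrete_flux_relation Omega phi uh qh.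
Hypothesis hibp : discrete_integration_by_parts M Omega GD GN.
Local Notation phistar := (conjugate phi).

Let mOmega : measurable Omega.
Proof. by have [_ oO _ _ _] := hO; exact: open_measurable_rV. Qed.

Let Omega_lty : (leb Omega < +oo)%E.
Proof. by have [_ _ _ bO _] := hO; exact: lebesgue_bounded_lty. Qed.

Lemma bmeas_piecewise_cst (h : elt M -> rV) j :
  bounded_measurable Omega (fun x => piecewise (fun i _ => h i) x ord0 j).
Proof.
under eq_fun do rewrite piecewise_coord.
by apply: (bmeas_piecewise hT hO) => i; exact: bmeas_cst.
Qed.

Lemma measurable_piecewise_cst (h : elt M -> rV) :
  measurable_fun Omega (piecewise (fun i _ => h i) : rV -> rV).
Proof.
apply: measurable_rVP => // j.
by case: (bmeas_piecewise_cst h j).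
Qed.

Let m_grad (v : p1 M) : measurable_fun Omega (p1_grad v).
Proof. exact: measurable_piecewise_cst. Qed.

Let m_Pi (r : rV -> rV) : measurable_fun Omega (Pihv M r).
Proof. exact: measurable_piecewise_cst. Qed.

Lemma measurable_bregman_phi (a b : rV -> rV) : measurable_fun Omega a ->
  measurable_fun Omega b ->
  measurable_fun Omega (fun x => bregman phi (a x) (b x)).
Proof.
by apply: measurable_bregman => //; [exact: Nfunction_nd|exact: rderiv_nd].
Qed.

Lemma measurable_bregman_phistar (a b : rV -> rV) : measurable_fun Omega a ->
  measurable_fun Omega b ->
  measurable_fun Omega (fun x => bregman phistar (a x) (b x)).
Proof.
apply: measurable_bregman => //; first exact: (conjugate_nd cuc0 hN hU).
exact: (rderiv_conjugate_nd cuc0 Cuc0 hN hU).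
Qed.

Let bregman_phistar_ge0 (a b : rV) : 0 <= bregman phistar a b.
Proof.
rewrite (bregman_conjugateV cuc0 Cuc0 hN hU); exact: bregman_ge0.
Qed.

(** Pointwise, [bregman_three_points] and [young_gap] give the identity up to the
    cross term of [discrete_orthogonality]. *)
Lemma discrete_error_identity (vh : p1 M) (rh : rV -> rV) :
  VhD GD vh -> Kh M Omega GN f F g rh ->
  (\int[leb]_(x in Omega) (bregman phi (p1_grad vh x) (p1_grad uh x))%:E +
   \int[leb]_(x in Omega) (bregman phistar (Pihv M rh x) (Pihv M qh x))%:E =
   \int[leb]_(x in Omega)
     (phi (enorm (p1_grad vh x)) - dot (Pihv M rh x) (p1_grad vh x)
      + phistar (enorm (Pihv M rh x)))%:E)%E.
Proof.
move=> vD rK; have [uD _ qK _] := hD.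
have mp := measurable_bregman_phi (m_grad vh) (m_grad uh).
have md := measurable_bregman_phistar (m_Pi rh) (m_Pi qh).
rewrite -ge0_integralD//; first last.
- exact/measurable_EFinP.
- by move=> x _; rewrite lee_fin bregman_phistar_ge0.
- exact/measurable_EFinP.
- by move=> x _; rewrite lee_fin (bregman_ge0 hN).
under eq_integral do rewrite -EFinD.
apply: (@ge0_integral_perturb _ _ _ _ _ _ _ _ (fun x =>
   dot (Pihv M rh x - Pihv M qh x) (p1_grad vh x - p1_grad uh x))) => //.
- exact: measurable_funD.
- apply: measurable_funD.
    apply: measurable_funB; last exact: measurable_dot.
    by apply: measurable_nd_enorm => //; exact: Nfunction_nd.
  by apply: measurable_nd_enorm => //; exact: (conjugate_nd cuc0 hN hU).
- apply: bmeas_dot => j; under eq_fun do rewrite !mxE.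
    by apply: bmeasB; exact: bmeas_piecewise_cst.
  by apply: bmeasB; exact: bmeas_piecewise_cst.
- by move=> x _; rewrite addr_ge0// (bregman_ge0 hN).
- by move=> x _; rewrite (young_gap cuc0 Cuc0 hN hU) (bregman_ge0 hN).
- exact: (discrete_orthogonality hT hO hibp vD uD rK qK).
apply: filterS hflux => x qE Ox.
rewrite (young_gap cuc0 Cuc0 hN hU) (bregman_conjugateV cuc0 Cuc0 hN hU) qE//.
by rewrite (fluxK cuc0 Cuc0 hN hU) bregman_three_points (fluxVK cuc0 Cuc0 hN hU).
Qed.

Variables (gradu q : rV -> rV).
Hypothesis m_gradu : measurable_fun Omega gradu.
Hypothesis m_q : measurable_fun Omega q.
Hypothesis qE : {ae leb, forall x, Omega x -> q x = flux phi (gradu x)}.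

Let kap := quasi_const cuc Cuc.

Let kap0 : 0 < kap.
Proof. exact: quasi_const_gt0. Qed.

(** With [Z] the distance of [vh] from [uh], the quasi-triangle inequality bounds
    both parts of the error by [Z] and the distance [X] of [vh] from the exact
    gradient. The error identity bounds [Z] by the divergence of the discrete
    gradient of [vh] from the gradient that corresponds to [rh], and this in
    turn by [X + Y], passing through the exact gradient. *)
Lemma quasi_optimal (vh : p1 M) (rh : rV -> rV) :
  VhD GD vh -> Kh M Omega GN f F g rh ->
  (Eh Omega phi gradu q uh qh <= (2 * kap * (kap + 1))%:E *
    (\int[leb]_(x in Omega) (bregman phi (p1_grad vh x) (gradu x))%:E +
     \int[leb]_(x in Omega) (bregman phistar (Pihv M rh x) (q x))%:E))%E.
Proof.
move=> vD rK.
pose X := (\int[leb]_(x in Omega) (bregman phi (p1_grad vh x) (gradu x))%:E)%E.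
pose Y := (\int[leb]_(x in Omega) (bregman phistar (Pihv M rh x) (q x))%:E)%E.
pose Z := (\int[leb]_(x in Omega) (bregman phi (p1_grad vh x) (p1_grad uh x))%:E)%E.
have X0 : (0 <= X)%E.
  by apply: integral_ge0 => x _; rewrite lee_fin (bregman_ge0 hN).
have Y0 : (0 <= Y)%E by apply: integral_ge0 => x _; rewrite lee_fin.
have Z_le : (Z <= kap%:E * (X + Y))%E.
  apply: (@le_trans _ _ (\int[leb]_(x in Omega)
     (phi (enorm (p1_grad vh x)) - dot (Pihv M rh x) (p1_grad vh x)
      + phistar (enorm (Pihv M rh x)))%:E)%E).
    rewrite -discrete_error_identity// leeDl//.
    by apply: integral_ge0 => x _; rewrite lee_fin.
  apply: integral_le_comb => //.
  - exact: ltW.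
  - apply: measurable_funD.
      apply: measurable_funB; last exact: measurable_dot.
      by apply: measurable_nd_enorm => //; exact: Nfunction_nd.
    by apply: measurable_nd_enorm => //; exact: (conjugate_nd cuc0 hN hU).
  - exact: measurable_bregman_phi.
  - exact: measurable_bregman_phistar.
  - by move=> x _; rewrite (young_gap cuc0 Cuc0 hN hU) (bregman_ge0 hN).
  - by move=> x _; exact: (bregman_ge0 hN).
  apply: filterS qE => x + Ox => /(_ Ox) ->.
  rewrite (young_gap cuc0 Cuc0 hN hU) (bregman_conjugateV cuc0 Cuc0 hN hU).
  rewrite (fluxK cuc0 Cuc0 hN hU); exact: (bregman_quasi_triangle cuc0 Cuc0 hN hU).
have E1 : (\int[leb]_(x in Omega) (bregman phi (p1_grad uh x) (gradu x))%:E <=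
    kap%:E * (Z + X))%E.
  apply: integral_le_comb => //.
  - exact: ltW.
  - exact: measurable_bregman_phi.
  - exact: measurable_bregman_phi.
  - exact: measurable_bregman_phi.
  - by move=> x _; exact: (bregman_ge0 hN).
  - by move=> x _; exact: (bregman_ge0 hN).
  - by move=> x _; exact: (bregman_ge0 hN).
  by apply: aeW => x _; exact: (bregman_quasi_triangleC cuc0 Cuc0 hN hU).
have E2 : (\int[leb]_(x in Omega) (bregman phistar (Pihv M qh x) (q x))%:E <=
    kap%:E * (Z + X))%E.
  apply: integral_le_comb => //.
  - exact: ltW.
  - exact: measurable_bregman_phistar.
  - exact: measurable_bregman_phi.
  - exact: measurable_bregman_phi.
  - by move=> x _; exact: (bregman_ge0 hN).
  - by move=> x _; exact: (bregman_ge0 hN).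
  apply: filterS2 qE hflux => x + + Ox => /(_ Ox) -> /(_ Ox) ->.
  rewrite (bregman_conjugate cuc0 Cuc0 hN hU).
  exact: (bregman_quasi_triangleCC cuc0 Cuc0 hN hU).
rewrite /Eh; apply: (le_trans (leeD E1 E2)); rewrite -/X -/Y.
have kapE0 : (0 <= kap%:E)%E by rewrite lee_fin ltW.
have ZX : (Z + X <= (kap + 1)%:E * (X + Y))%E.
  rewrite EFinD ge0_muleDl ?lee_fin ?ler01 ?(ltW kap0)//.
  by rewrite leeD// mul1e leeDl.
have kZX : (kap%:E * (Z + X) <= (kap * (kap + 1))%:E * (X + Y))%E.
  by rewrite (EFinM kap) -muleA lee_wpmul2l.
by rewrite -(mulrA 2) (EFinM 2) -muleA mule_natl mule2n leeD.
Qed.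

End error_identity.

Theorem theorem5p1 (R : realType) (cuc Cuc : R) :
  0 < cuc -> 0 < Cuc ->
  exists c C : R, [/\ 0 < c, 0 < C &
    forall (phi : R -> R) (n : nat) (Omega GD GN : set 'rV[R]_n.+1)
      (M : mesh R n) (kappa : R)
      (f : 'rV[R]_n.+1 -> R) (F : 'rV[R]_n.+1 -> 'rV[R]_n.+1)
      (g : 'rV[R]_n.+1 -> R)
      (u : @sobolev R n) (q : 'rV[R]_n.+1 -> 'rV[R]_n.+1)
      (uh : p1 M) (qh : 'rV[R]_n.+1 -> 'rV[R]_n.+1),
    is_Nfunction phi -> uniformly_convex cuc Cuc phi ->
    bounded_lipschitz_domain Omega ->
    triangulation M Omega -> shape_regular M kappa ->
    boundary_parts M Omega GD GN ->
    orlicz (lebesgue_rV R n.+1) (conjugate phi) Omega f ->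
    orlicz_vec (lebesgue_rV R n.+1) (conjugate phi) Omega F ->
    orlicz (surf M Omega) (conjugate phi) GN g ->
    primal_solution M Omega GD GN phi f F g u ->
    dual_solution Omega phi u q ->
    discrete_solution Omega GD GN phi f F g uh qh ->
    discrete_flux_relation Omega phi uh qh ->
    discrete_integration_by_parts M Omega GD GN ->
    (forall (vh : p1 M) (rh : 'rV[R]_n.+1 -> 'rV[R]_n.+1),
       VhD GD vh -> Kh M Omega GN f F g rh ->
       (\int[lebesgue_rV R n.+1]_(x in Omega)
          (bregman phi (p1_grad vh x) (p1_grad uh x))%:E +
        \int[lebesgue_rV R n.+1]_(x in Omega)
          (bregman (conjugate phi) (Pihv M rh x) (Pihv M qh x))%:E =
        \int[lebesgue_rV R n.+1]_(x in Omega)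
          (phi (enorm (p1_grad vh x)) - dot (Pihv M rh x) (p1_grad vh x)
           + conjugate phi (enorm (Pihv M rh x)))%:E)%E) /\
    (c%:E * Bh M Omega GD GN phi f F g (sgrad u) q
       <= Eh Omega phi (sgrad u) q uh qh)%E /\
    (Eh Omega phi (sgrad u) q uh qh
       <= C%:E * Bh M Omega GD GN phi f F g (sgrad u) q)%E].
Proof.
move=> cuc0 Cuc0; have k0 := quasi_const_gt0 cuc0 Cuc0.
exists 1, (2 * quasi_const cuc Cuc * (quasi_const cuc Cuc + 1)).
have C0 : 0 < 2 * quasi_const cuc Cuc * (quasi_const cuc Cuc + 1).
  by apply: mulr_gt0; [apply: mulr_gt0 => //|apply: addr_gt0].
split=> // phi n Omega GD GN M kappa f F g u q uh qh hN hU hO hT _ _ _ _ _.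
move=> [[_ [mG _] _ _ _] _] [[mq _] qE] hD hflux hibp.
split; first by move=> vh rh; exact: (discrete_error_identity cuc0 Cuc0).
have [uD _ qK _] := hD; split.
  by rewrite mul1e; apply: leeD; apply: ereal_inf_lbound; [exists uh|exists qh].
apply: le_mule_ereal_infD => //.
- move=> _ [v _ <-]; apply: integral_ge0 => x _.
  by rewrite lee_fin (bregman_ge0 hN).
- move=> _ [r _ <-]; apply: integral_ge0 => x _.
  by rewrite lee_fin (bregman_conjugateV cuc0 Cuc0 hN hU) (bregman_ge0 hN).
move=> _ _ [v vD <-] [r rK <-].
exact: (quasi_optimal cuc0 Cuc0 hN hU hT hO hD hflux hibp mG mq qE vD rK).
Qed.
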